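(* Let $R$ be a Dedekind domain and let $\bar p$ be a positive perversity on $[1]=\{0<1\}$ (i.e. $\bar p(0)\ge0$, $\bar p(0)\in\mathbb N\cup\{\infty\}$). For all integers $n,k\ge0$ there are isomorphisms $$\mathscr H^k_{\bar p}\big(\mathtt K(R,n,[1],\bar0);R\big)\;\cong\;\mathrm{Nat}_R(\mathscr H^n_{\bar0},\mathscr H^k_{\bar p})\;\cong\;H^k(K(R,n);R),$$ where $\bar0$ is the zero perversity, $\mathrm{Nat}_R(\mathscr H^n_{\bar0},\mathscr H^k_{\bar p})$ is the set of natural transformations between the blown-up cohomology functors $\mathscr H^n_{\bar0}(-;R)$ and $\mathscr H^k_{\bar p}(-;R)$ on $\mathrm{Sset}_{[1]}$, and $H^k(K(R,n);R)$ is the ordinary cohomology of the classical Eilenberg–MacLane space.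
   Context: **Simplicial sets over $[1]$.** $N([1])=\Delta[1]$, and $\mathrm{Sset}_{[1]}$ is the category of simplicial maps $\Psi_K\colon K\to\Delta[1]$ with simplicial maps over $\Delta[1]$, equivalently of presheaves on the category of simplices of $\Delta[1]$. **Blown-up cochains.** A perversity on $[1]$ is given by its value $\bar p(0)\in\mathbb Z\cup\{\pm\infty\}$; $\bar p(1)=0$. $N^*(-)$ denotes normalized simplicial cochains with coefficients in $R$. A simplex of $N([1])$ is $\Delta[a]*\Delta[b]$ with $a,b\ge-1$ not both $-1$ ($a+1$ vertices over $0$, $b+1$ vertices over $1$; $-1$ means empty). It is regular if $b\ge0$. Let $c\Delta[a]$ be the cone with apex $v$ as last vertex, $c\emptyset=\{v\}$. For regular simplices set $\widetilde N^*(\Delta[a]*\Delta[b])=N^*(c\Delta[a])\otimes N^*(\Delta[b])$ (equal to $N^*(\Delta[b])$ if $a=-1$), with basis $\mathbf 1_{(F_0,\varepsilon)}\otimes\mathbf 1_{F_1}$, where $(F_0,0)$ is a non-empty face $F_0$ of $\Delta[a]$ and $(F_0,1)$ is $cF_0$ with $F_0$ a possibly empty face. The perverse degree along $0$ of such a basis element is $\dim F_1$ if $\varepsilon=0$ and $-\infty$ if $\varepsilon=1$; of a linear combination, the maximum over the terms with non-zero coefficient ($-\infty$ for $0$). $\widetilde N^*_{\bar p}(\Delta[a]*\Delta[b])$ consists of the $\omega$ such that $\omega$ and $\delta\omega$ have perverse degree $\le\bar p(0)$. Put $\widetilde N^*_{\bar p}=0$ on non-regular simplices. With restriction along maps of simplices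 over $\Delta[1]$ (for a simplex with no vertex over $0$, via the restriction $N^*(c\Delta[a])\to N^*(\{v\})=R$), this is a presheaf on the simplices of $\Delta[1]$. For $\Psi_K\in\mathrm{Sset}_{[1]}$, $\widetilde N^k_{\bar p}(\Psi_K)=\mathrm{Hom}_{\mathrm{Sset}_{[1]}}(\Psi_K,\widetilde N^k_{\bar p}(\bullet))$ and $\mathscr H^*_{\bar p}(\Psi_K;R)$ is the cohomology of $\widetilde N^*_{\bar p}(\Psi_K)$. **Eilenberg–MacLane spaces.** $\mathtt K(R,n,[1],\bar0)\in\mathrm{Sset}_{[1]}$ is the presheaf $\sigma\mapsto\mathcal Z^n\widetilde N^*_{\bar0}(\sigma)$ (degree $n$ cocycles). The classical $K(R,n)$ is the simplicial set with $k$-simplices $\mathcal Z^nN^*(\Delta[k];R)$. **Natural transformations** are taken between the underlying set-valued (contravariant) functors: components are not required to be additive or $R$-linear. *)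

(* Defs.v *)
From HB Require Import structures.
From mathcomp Require Import all_boot all_order all_algebra.
From mathcomp Require Import boolp classical_sets functions constructive_ereal.
From mathcomp Require Import zify.

Set Implicit Arguments.
Unset Strict Implicit.
Unset Printing Implicit Defensive.

Import Order.TTheory GRing.Theory Num.Theory.
Local Open Scope ring_scope.
Local Open Scope quotient_scope.

Section Dedekind.
Variable R : idomainType.

(* [idealr_closed] is about proper ideals; the unit ideal is principal, so
   leaving it out changes nothing. *)
Definition noetherian := forall I : {pred R}, idealr_closed I ->
  exists s : seq R, forall x,
    x \in I <-> exists c : 'I_(size s) -> R, x = \sum_(i < size s) c i * s`_i.

Definition integrally_closed := forall z : {fraction R},
  integralOver (@tofrac R) z -> exists x : R, z = tofrac x.

Definition maximal_ideal (I : {pred R}) := idealr_closed I /\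
  forall J : {pred R}, idealr_closed J -> {subset I <= J} -> {subset J <= I}.

(* Fields are allowed. *)
Definition dedekind := [/\ noetherian, integrally_closed &
  forall I : {pred R}, idealr_closed I -> prime_idealr_closed I ->
    (exists2 x, x \in I & x != 0) -> maximal_ideal I].

End Dedekind.

Section Complexes.
Variable R : pzRingType.

Record complex := Complex {
  cochain :> nat -> lmodType R;
  diff : forall n, {linear cochain n -> cochain n.+1};
  diffK : forall n x, diff n.+1 (diff n x) = 0 }.

Record cmap (C D : complex) := CMap {
  capp :> forall n, {linear C n -> D n};
  cappd : forall n x, capp n.+1 (diff C n x) = diff D n (capp n x) }.

Definition coboundary (C : complex) n : C n -> Prop :=
  match n with
  | 0 => fun x => x = 0
  | m.+1 => fun x => exists y : C m, x = diff C m y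
  end.

Lemma coboundary0 (C : complex) n : coboundary (0 : C n).
Proof. by case: n => [|n] //; exists 0; rewrite linear0. Qed.

Lemma coboundary_linear (C : complex) n a (x y : C n) :
  coboundary x -> coboundary y -> coboundary (a *: x + y).
Proof.
case: n x y => [|n] x y /=; first by move=> -> ->; rewrite scaler0 addr0.
by move=> [u ->] [v ->]; exists (a *: u + v); rewrite linearP.
Qed.

Section Cohomology.
Variables (C : complex) (n : nat).

Definition is_cocycle : {pred C n} := fun x => diff C n x == 0.

Lemma is_cocycle_submod : submod_closed is_cocycle.
Proof.
split=> [|a x y]; rewrite !unfold_in ?linear0 // => /eqP dx /eqP dy.
by rewrite linearP dx dy scaler0 addr0.
Qed.
HB.instance Definition _ :=
  GRing.isSubmodClosed.Build R (C n) is_cocycle is_cocycle_submod.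

Definition cocycle := {x : C n | x \in is_cocycle}.
HB.instance Definition _ := SubChoice.on cocycle.
HB.instance Definition _ :=
  [SubChoice_isSubLmodule of cocycle by <:].

Definition is_coboundary : {pred cocycle} := fun z => `[< coboundary (val z) >].

Lemma is_coboundary_submod : submod_closed is_coboundary.
Proof.
split=> [|a x y]; rewrite !unfold_in; first exact/asboolP/coboundary0.
by move=> /asboolP bx /asboolP yb; apply/asboolP/coboundary_linear.
Qed.
HB.instance Definition _ :=
  GRing.isSubmodClosed.Build R cocycle is_coboundary is_coboundary_submod.

Definition cohomology := Quotient.quot is_coboundary.
HB.instance Definition _ := GRing.Zmodule.on cohomology.

Definition coclass (z : cocycle) : cohomology := \pi_(Quotient.quot is_coboundary) z.

Lemma coclassP (x : cohomology) : exists z, x = coclass z.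
Proof. by exists (repr x); rewrite /coclass reprK. Qed.

Lemma coclass_eq (x y : cocycle) :
  coclass x = coclass y <-> coboundary (val x - val y).
Proof.
rewrite /coclass -linearB; split=> [/eqP|b].
  by rewrite -Quotient.idealrBE => /asboolP.
by apply/eqP; rewrite -Quotient.idealrBE; apply/asboolP.
Qed.

Lemma coclassD x y : coclass (x + y) = coclass x + coclass y.
Proof. by rewrite /coclass raddfD. Qed.

Definition cohomology_scale (a : R) (x : cohomology) : cohomology :=
  coclass (a *: repr x).

Lemma cohomology_scaleE a z : cohomology_scale a (coclass z) = coclass (a *: z).
Proof.
apply/eqP; rewrite /cohomology_scale /coclass -Quotient.idealrBE -scalerBr.
apply: (rpredZ (s := is_coboundary)).
by rewrite Quotient.idealrBE reprK.
Qed.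

Fact cohomology_scaleA a b x :
  cohomology_scale a (cohomology_scale b x) = cohomology_scale (a * b) x.
Proof. by have [z ->] := coclassP x; rewrite !cohomology_scaleE scalerA. Qed.

Fact cohomology_scale1 : left_id 1 cohomology_scale.
Proof.
by move=> x; have [z ->] := coclassP x; rewrite cohomology_scaleE scale1r.
Qed.

Fact cohomology_scaleDr : right_distributive cohomology_scale +%R.
Proof.
move=> a x y; have [z ->] := coclassP x; have [t ->] := coclassP y.
by rewrite -coclassD !cohomology_scaleE scalerDr coclassD.
Qed.

Fact cohomology_scaleDl x : {morph cohomology_scale^~ x : a b / a + b}.
Proof.
move=> a b; have [z ->] := coclassP x.
by rewrite !cohomology_scaleE scalerDl coclassD.
Qed.

HB.instance Definition _ := GRing.Zmodule_isLmodule.Build R cohomology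
  cohomology_scaleA cohomology_scale1 cohomology_scaleDr cohomology_scaleDl.

Lemma coclassZ a z : coclass (a *: z) = a *: coclass z.
Proof. by rewrite -cohomology_scaleE. Qed.

End Cohomology.

Arguments is_cocycle C n : clear implicits.

Section CohomologyMap.
Variables (C D : complex) (f : cmap C D) (n : nat).

Fact cocycle_map_subproof (z : cocycle C n) : f n (val z) \in is_cocycle D n.
Proof.
by rewrite unfold_in -cappd (eqP (valP z)) linear0.
Qed.

Definition cocycle_map (z : cocycle C n) : cocycle D n :=
  Sub (f n (val z)) (cocycle_map_subproof z).

Lemma cmap_coboundary (x : C n) : coboundary x -> coboundary (f n x).
Proof.
case: n x => [|m] x /=; first by move=> ->; rewrite linear0.
by move=> [y ->]; exists (f m y); rewrite cappd.
Qed.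

Definition cohomology_map (x : cohomology C n) : cohomology D n :=
  coclass (cocycle_map (repr x)).

Lemma cohomology_mapE z : cohomology_map (coclass z) = coclass (cocycle_map z).
Proof.
apply/coclass_eq; rewrite /= -linearB.
have: coboundary (val (repr (coclass z)) - val z).
  by apply/coclass_eq; rewrite /coclass reprK.
exact: cmap_coboundary.
Qed.

Lemma cohomology_map_linear : linear cohomology_map.
Proof.
move=> a x y; have [z ->] := coclassP x; have [t ->] := coclassP y.
rewrite -coclassZ -coclassD !cohomology_mapE -coclassZ -coclassD.
congr coclass; by apply: val_inj; rewrite /= !linearP.
Qed.
HB.instance Definition _ := GRing.isLinear.Build R _ _ _ cohomology_map
  cohomology_map_linear.

End CohomologyMap.

End Complexes.

Arguments cocycle_map {R C D} f {n} z.
Arguments cohomology_map {R C D} f {n} x.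
Arguments cocycle {R} C n.
Arguments cohomology {R} C n.

(* Monotone maps {0, ..., m-1} -> {0, ..., n-1}.  They are indexed by numbers
   of vertices, so that the empty simplex is allowed: the simplicial category
   consists of the [mono m.+1 n.+1]. *)
Record mono (m n : nat) := Mono {
  mono_fun :> 'I_m -> 'I_n;
  monoP : {homo mono_fun : i j / (i <= j)%N} }.

Lemma mono_ext m n (f g : mono m n) : f =1 g -> f = g.
Proof.
case: f g => [f hf] [g hg] /= /funext fg.
by rewrite fg in hf *; congr Mono; exact: Prop_irrelevance.
Qed.

Definition mono_id n : mono n n := Mono (fun i j => id).

Fact mono_comp_subproof m n p (g : mono n p) (f : mono m n) :
  {homo (fun i => g (f i)) : i j / (i <= j)%N}.
Proof. by move=> i j ij; do 2!apply: monoP. Qed.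

Definition mono_comp m n p (g : mono n p) (f : mono m n) : mono m p :=
  Mono (mono_comp_subproof g f).

Lemma mono_compid m n (f : mono m n) : mono_comp f (mono_id m) = f.
Proof. exact: mono_ext. Qed.

Lemma mono_idcomp m n (f : mono m n) : mono_comp (mono_id n) f = f.
Proof. exact: mono_ext. Qed.

Lemma mono_compA m n p q (h : mono p q) (g : mono n p) (f : mono m n) :
  mono_comp h (mono_comp g f) = mono_comp (mono_comp h g) f.
Proof. exact: mono_ext. Qed.

Fact face_subproof n (l : 'I_n.+1) : {homo lift l : i j / (i <= j)%N}.
Proof. by move=> i j; rewrite /= leq_bump2. Qed.

Definition face n (l : 'I_n.+1) : mono n n.+1 := Mono (@face_subproof n l).

(* The map induced on cones, the apex being the last vertex. *)
Definition cone_fun m n (f : mono m n) (i : 'I_m.+1) : 'I_n.+1 :=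
  if unlift ord_max i is Some j then lift ord_max (f j) else ord_max.

Lemma cone_fun_lift m n (f : mono m n) i :
  cone_fun f (lift ord_max i) = lift ord_max (f i).
Proof. by rewrite /cone_fun liftK. Qed.

Lemma cone_fun_max m n (f : mono m n) : cone_fun f ord_max = ord_max.
Proof. by rewrite /cone_fun unlift_none. Qed.

Fact cone_subproof m n (f : mono m n) : {homo cone_fun f : i j / (i <= j)%N}.
Proof.
move=> i j; case: (unliftP ord_max i) => [i'|] ->; last first.
  case: (unliftP ord_max j) => [j'|] -> //.
  by rewrite lift_max /= leqNgt ltn_ord.
case: (unliftP ord_max j) => [j'|] ->; last first.
  by rewrite cone_fun_max => _; rewrite -ltnS ltn_ord.
by rewrite !cone_fun_lift !lift_max => /monoP.
Qed.

Definition cone m n (f : mono m n) : mono m.+1 n.+1 := Mono (cone_subproof f).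

Lemma cone_id n : cone (mono_id n) = mono_id n.+1.
Proof.
apply: mono_ext => i /=; case: (unliftP ord_max i) => [j|] ->.
  by rewrite cone_fun_lift.
by rewrite cone_fun_max.
Qed.

Lemma cone_comp m n p (g : mono n p) (f : mono m n) :
  cone (mono_comp g f) = mono_comp (cone g) (cone f).
Proof.
apply: mono_ext => i /=; case: (unliftP ord_max i) => [j|] ->.
  by rewrite !cone_fun_lift.
by rewrite !cone_fun_max.
Qed.

Lemma cone_fun_eq_max m n (f : mono m n) i :
  (cone_fun f i == ord_max) = (i == ord_max).
Proof.
case: (unliftP ord_max i) => [j|] ->; last by rewrite cone_fun_max !eqxx.
by rewrite cone_fun_lift ![_ == ord_max]eq_sym !(negPf (neq_lift _ _)).
Qed.

Record sset := SSet {
  simplex :> nat -> Type;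
  act : forall m n, mono m.+1 n.+1 -> simplex n -> simplex m;
  act_id : forall n (x : simplex n), act (mono_id n.+1) x = x;
  act_comp : forall m n p (g : mono n.+1 p.+1) (f : mono m.+1 n.+1) x,
    act (mono_comp g f) x = act f (act g x) }.

Record smap (X Y : sset) := SMap {
  smap_app :> forall n, X n -> Y n;
  smap_act : forall m n (f : mono m.+1 n.+1) x,
    smap_app (act f x) = act f (smap_app x) }.

(* The standard simplex on [n] vertices, which is empty for [n = 0]. *)
Definition standard (n : nat) : sset :=
  @SSet (fun k => mono k.+1 n) (fun _ _ f x => mono_comp x f)
    (fun _ x => mono_compid x) (fun _ _ _ g f x => mono_compA x g f).

Definition standard_map m n (f : mono m n) : smap (standard m) (standard n) :=
  @SMap (standard m) (standard n) (fun _ x => mono_comp f x)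
    (fun _ _ g x => mono_compA f x g).

(* Equivalently, x = s_i^* y for a codegeneracy s_i: a monotone map that
   decreases the dimension identifies two consecutive vertices. *)
Definition degenerate (X : sset) k (x : X k) :=
  exists m (f : mono k.+1 m.+1) (y : X m), (m < k)%N /\ x = act f y.

Lemma smap_degenerate X Y (u : smap X Y) k (x : X k) :
  degenerate x -> degenerate (u k x).
Proof. by case=> m [f [y [mk ->]]]; exists m, f, (u m y); rewrite smap_act. Qed.

Definition collapses k n (h : mono k n) i :=
  exists (i0 : (i < k)%N) (i1 : (i.+1 < k)%N), h (Ordinal i0) = h (Ordinal i1).

Lemma mono_collapses k m (h : mono k.+1 m.+1) :
  (m < k)%N -> exists i, collapses h i.
Proof.
move=> mk; apply: contrapT => nc.
have lt_h i (i0 : (i < k.+1)%N) : (i <= h (Ordinal i0))%N.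
  elim: i i0 => // i IHi i1; have i0 := ltnW i1.
  apply: (leq_ltn_trans (IHi i0)); rewrite ltn_neqAle monoP ?leqnSn // andbT.
  by apply/eqP => /val_inj h01; apply: nc; exists i, i0, i1.
have := leq_ltn_trans (lt_h k (ltnSn k)) (ltn_ord _).
by rewrite ltnS leqNgt mk.
Qed.

Fact degen_subproof k i (hi : (i <= k)%N) (x : 'I_k.+2) : (unbump i x < k.+1)%N.
Proof.
rewrite /unbump; case: (ltnP i x) => [ix|xi] /=.
  by rewrite subn1 -ltnS (ltn_predK ix) ltn_ord.
by rewrite subn0 ltnS (leq_trans xi).
Qed.

Fact degen_mono k i (hi : (i <= k)%N) :
  {homo (fun x => Ordinal (degen_subproof hi x)) : x y / (x <= y)%N}.
Proof. by move=> x y /= xy; rewrite -leq_bump unbumpKcond (leq_trans xy) ?leq_addl. Qed.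

Definition degen k i (hi : (i <= k)%N) : mono k.+2 k.+1 := Mono (degen_mono hi).

Lemma collapses_factor k n (h : mono k.+2 n) i (hi : (i <= k)%N) :
  collapses h i ->
  h = mono_comp (mono_comp h (face (Ordinal (leqW hi : i < k.+2)%N))) (degen hi).
Proof.
move=> [i0 [i1 h01]]; apply: mono_ext => x /=.
have [xi|xi] := eqVneq (x : nat) i.
  have -> : x = Ordinal i0 by exact: val_inj.
  by rewrite h01; congr (h _); apply: val_inj; rewrite /= unbumpKcond eqxx.
by congr (h _); apply: val_inj; rewrite /= unbumpKcond (negPf xi).
Qed.

Lemma collapses_degenerate (X : sset) k m (h : mono k.+1 m.+1) (y : X m) i :
  collapses h i -> degenerate (act h y).
Proof.
move=> hi; case: k h hi => [|k] h hi; first by case: hi => ? [].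
have ik : (i <= k)%N by case: hi => ? [].
rewrite (collapses_factor ik hi) act_comp.
by exists k, (degen ik), (act (mono_comp h (face (Ordinal (leqW ik : i < k.+2)%N))) y).
Qed.

Lemma lfunE (R : pzRingType) (T : Type) (V : lmodType R) a (f g : T -> V) x :
  (a *: f + g) x = a *: f x + g x.
Proof. by []. Qed.

Lemma alternating_sum (R : pzRingType) (V : lmodType R) n (F : nat -> nat -> V) :
  (forall l j, (j <= l < n)%N -> F l.+1 j = - F j l) ->
  \sum_(l < n.+1) \sum_(j < n) F l j = 0.
Proof.
move=> hF.
have split2 (l : 'I_n.+1) : \sum_(j < n) F l j =
    \sum_(j < n | (j < l)%N) F l j + \sum_(j < n | (l <= j)%N) F l j.
  rewrite (bigID (fun j : 'I_n => (j < l)%N)) /=; congr (_ + _).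
  by apply: eq_bigl => j; rewrite -leqNgt.
rewrite (eq_bigr _ (fun l _ => split2 l)) big_split /= big_ord_recl big_pred0 //.
rewrite add0r [X in _ + X]big_ord_recr /= [X in _ + (_ + X)]big_pred0; last first.
  by move=> j; rewrite leqNgt ltn_ord.
rewrite addr0 [X in _ + X](exchange_big_dep predT) //= -big_split big1 // => l _ /=.
apply/eqP; rewrite addr_eq0 -sumrN; apply/eqP; apply: eq_bigr => j jl.
by rewrite hF // ltn_ord andbT -ltnS.
Qed.

Section Cochains.
Variables (R : pzRingType) (X : sset).

Definition cob k (c : X k -> R^o) : X k.+1 -> R^o :=
  fun x => \sum_(l < k.+2) (-1) ^+ l *: c (act (face l) x).

Lemma cob_linear k : linear (@cob k).
Proof.
move=> a c d; apply/funext => x; rewrite lfunE /cob scaler_sumr -big_split /=.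
by apply: eq_bigr => l _; rewrite lfunE scalerDr !scalerA commr_sign.
Qed.
HB.instance Definition _ k := GRing.isLinear.Build R _ _ _ (@cob k) (@cob_linear k).

Lemma cob_cob k (c : X k -> R^o) : cob (cob c) = 0.
Proof.
apply/funext => x; rewrite /cob.
pose F l j : R^o := (-1) ^+ (l + j) *:
  c (act (face (inord j : 'I_k.+2)) (act (face (inord l : 'I_k.+3)) x)).
transitivity (\sum_(l < k.+3) \sum_(j < k.+2) F l j).
  apply: eq_bigr => l _; rewrite scaler_sumr; apply: eq_bigr => j _.
  by rewrite scalerA -exprD /F !inord_val.
apply: alternating_sum => l j /andP[jl lk]; rewrite /F.
rewrite addSn exprS addnC -scalerA scaleN1r -!act_comp; congr (- (_ *: c (act _ _))).
by apply: mono_ext => i; apply: val_inj; rewrite /= !inordK /bump; lia.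
Qed.

Definition normalized k (c : X k -> R^o) := forall x, degenerate x -> c x = 0.

Lemma normalized_cob k (c : X k -> R^o) : normalized c -> normalized (cob c).
Proof.
move=> nc _ [m [h [y [mk ->]]]].
have [i hi] := mono_collapses h mk; have [i0 [i1 h01]] := hi.
rewrite /cob (bigD1 (Ordinal i0)) //= (bigD1 (Ordinal i1)) /=; last first.
  by rewrite -val_eqE /= gtn_eqF.
rewrite big1 ?addr0 => [|l /andP[]]; last first.
  rewrite -!val_eqE /= => li0 li1; rewrite -act_comp nc ?scaler0 //.
  have lk := ltn_ord l; have [il|il] := ltnP i l.
    apply: (@collapses_degenerate _ _ _ _ _ i).
    have j0 : (i < k.+1)%N by lia.
    have j1 : (i.+1 < k.+1)%N by lia.
    exists j0, j1; transitivity (h (Ordinal i0)).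
      by congr (h _); apply: val_inj; rewrite /= /bump; lia.
    by rewrite h01; congr (h _); apply: val_inj; rewrite /= /bump; lia.
  apply: (@collapses_degenerate _ _ _ _ _ i.-1).
  have j0 : (i.-1 < k.+1)%N by lia.
  have j1 : (i.-1.+1 < k.+1)%N by lia.
  exists j0, j1; transitivity (h (Ordinal i0)).
    by congr (h _); apply: val_inj; rewrite /= /bump; lia.
  by rewrite h01; congr (h _); apply: val_inj; rewrite /= /bump; lia.
have -> : act (face (Ordinal i1)) (act h y) = act (face (Ordinal i0)) (act h y).
  rewrite -!act_comp; congr (act _ y); apply: mono_ext => x /=.
  have [xi|xi] := eqVneq (x : nat) i; last first.
    by congr (h _); apply: val_inj; rewrite /= /bump; lia.
  transitivity (h (Ordinal i0)).
    by congr (h _); apply: val_inj; rewrite /= /bump; lia.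
  by rewrite h01; congr (h _); apply: val_inj; rewrite /= /bump; lia.
by rewrite exprS -scalerA scaleN1r subrr.
Qed.

Definition is_normalized k : {pred X k -> R^o} := fun c => `[< normalized c >].

Fact is_normalized_submod k : submod_closed (@is_normalized k).
Proof.
split=> [|a c d]; rewrite !unfold_in; first exact/asboolP.
move=> /asboolP nc /asboolP nd; apply/asboolP => x dx.
by rewrite lfunE nc ?nd // scaler0 addr0.
Qed.
HB.instance Definition _ k := GRing.isSubmodClosed.Build R (X k -> R^o)
  (@is_normalized k) (@is_normalized_submod k).

Definition ncochain k := {c : X k -> R^o | c \in @is_normalized k}.
HB.instance Definition _ k := SubChoice.on (ncochain k).
HB.instance Definition _ k := [SubChoice_isSubLmodule of ncochain k by <:].

Fact ncob_subproof k (c : ncochain k) : cob (val c) \in @is_normalized k.+1.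
Proof.
have /asboolP nc := valP c; rewrite unfold_in; exact/asboolP/normalized_cob.
Qed.

Definition ncob k (c : ncochain k) : ncochain k.+1 :=
  Sub (cob (val c)) (ncob_subproof c).

Fact ncob_linear k : linear (@ncob k).
Proof. by move=> a c d; apply: val_inj; rewrite /= !linearP. Qed.
HB.instance Definition _ k := GRing.isLinear.Build R _ _ _ (@ncob k) (@ncob_linear k).

Fact ncobK k (c : ncochain k) : ncob (ncob c) = 0.
Proof. by apply: val_inj; rewrite /= cob_cob. Qed.

Definition ncomplex : complex R := @Complex R ncochain (fun k => @ncob k) ncobK.

End Cochains.

Arguments ncomplex : clear implicits.

Section CochainMap.
Variables (R : pzRingType) (X Y : sset) (u : smap X Y).

Fact nmap_subproof k (c : ncochain R Y k) :
  (fun x => val c (u k x)) \in @is_normalized R X k.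
Proof.
have /asboolP nc := valP c; rewrite unfold_in; apply/asboolP => x dx.
exact/nc/smap_degenerate.
Qed.

Definition nmap k (c : ncochain R Y k) : ncochain R X k :=
  Sub (fun x => val c (u k x)) (nmap_subproof c).

Fact nmap_linear k : linear (@nmap k).
Proof. by move=> a c d; apply: val_inj. Qed.
HB.instance Definition _ k := GRing.isLinear.Build R _ _ _ (@nmap k) (@nmap_linear k).

Fact nmap_cob k (c : ncochain R Y k) : nmap (ncob c) = ncob (nmap c).
Proof.
apply: val_inj; apply/funext => x /=; apply: eq_bigr => l _.
by rewrite smap_act.
Qed.

Definition ncomplex_map : cmap (ncomplex R Y) (ncomplex R X) :=
  @CMap R (ncomplex R Y) (ncomplex R X) (fun k => @nmap k) nmap_cob.

End CochainMap.

Arguments ncomplex_map R {X Y} u.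

Section EilenbergMacLane.
Variables (R : pzRingType) (n : nat).

Definition EM_simplex k := cocycle (ncomplex R (standard k.+1)) n.

Definition EM_act m k (f : mono m.+1 k.+1) : EM_simplex k -> EM_simplex m :=
  cocycle_map (ncomplex_map R (standard_map f)).

Fact EM_act_id k (z : EM_simplex k) : EM_act (mono_id k.+1) z = z.
Proof.
do 2!apply: val_inj; apply/funext => x.
by rewrite /= mono_idcomp.
Qed.

Fact EM_act_comp m k p (g : mono k.+1 p.+1) (f : mono m.+1 k.+1) z :
  EM_act (mono_comp g f) z = EM_act f (EM_act g z).
Proof.
by do 2!apply: val_inj; apply/funext => x; rewrite /= mono_compA.
Qed.

Definition EM_sset : sset := SSet EM_act_id EM_act_comp.

End EilenbergMacLane.

(* The simplex Delta[a] * Delta[b] of N([1]), with [nv0 = a + 1] vertices over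
   0 and [nv1 = b + 1] vertices over 1.  The vertices over 0 come first. *)
Record jsimplex := JSimplex {
  nv0 : nat;
  nv1 : nat;
  nv_gt0 : (0 < nv0 + nv1)%N }.

(* A monotone map over [1] is the join of its restrictions to the fibres. *)
Record jmap (s t : jsimplex) := JMap {
  jmap0 : mono (nv0 s) (nv0 t);
  jmap1 : mono (nv1 s) (nv1 t) }.

Definition jmap_id s : jmap s s := JMap (mono_id _) (mono_id _).

Definition jmap_comp s t u (g : jmap t u) (f : jmap s t) : jmap s u :=
  JMap (mono_comp (jmap0 g) (jmap0 f)) (mono_comp (jmap1 g) (jmap1 f)).

(* Simplicial sets over Delta[1], as presheaves on its category of simplices:
   [K s] is the set of the simplices of K lying over [s]. *)
Record sset1 := SSet1 {
  simplex1 :> jsimplex -> Type;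
  act1 : forall s t, jmap s t -> simplex1 t -> simplex1 s;
  act1_id : forall s (x : simplex1 s), act1 (jmap_id s) x = x;
  act1_comp : forall s t u (g : jmap t u) (f : jmap s t) x,
    act1 (jmap_comp g f) x = act1 f (act1 g x) }.

Record smap1 (K L : sset1) := SMap1 {
  smap1_app :> forall s, K s -> L s;
  smap1_act : forall s t (f : jmap s t) x,
    smap1_app (act1 f x) = act1 f (smap1_app x) }.

Lemma smap1_ext K L (u v : smap1 K L) : (forall s, u s =1 v s) -> u = v.
Proof.
case: u v => [u hu] [v hv] /= uv.
have {}uv : u = v by apply: functional_extensionality_dep => s; exact/funext.
by rewrite uv in hu *; congr SMap1; exact: Prop_irrelevance.
Qed.

Fact smap1_comp_subproof K L M (v : smap1 L M) (u : smap1 K L) s t (f : jmap s t) x :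
  v s (u s (act1 f x)) = act1 f (v t (u t x)).
Proof. by rewrite !smap1_act. Qed.

Definition smap1_comp K L M (v : smap1 L M) (u : smap1 K L) : smap1 K M :=
  SMap1 (smap1_comp_subproof v u).

Section ComplexPresheaves.
Variable R : pzRingType.

Record cpresheaf := CPresheaf {
  cobj :> jsimplex -> complex R;
  cact : forall s t, jmap s t -> cmap (cobj t) (cobj s);
  cact_id : forall s k x, cact (jmap_id s) k x = x;
  cact_comp : forall s t u (g : jmap t u) (f : jmap s t) k x,
    cact (jmap_comp g f) k x = cact f k (cact g k x) }.

Section Fixed.
Variable C : cpresheaf.

Definition degree_sset1 k : sset1 :=
  @SSet1 (fun s => C s k) (fun s t f => cact C f k)
    (fun s x => @cact_id C s k x) (fun s t u g f x => @cact_comp C s t u g f k x).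

Fact cocycle_act_id n s (z : cocycle (C s) n) :
  cocycle_map (cact C (jmap_id s)) z = z.
Proof. by apply: val_inj; rewrite /= cact_id. Qed.

Fact cocycle_act_comp n s t u (g : jmap t u) (f : jmap s t) (z : cocycle (C u) n) :
  cocycle_map (cact C (jmap_comp g f)) z =
  cocycle_map (cact C f) (cocycle_map (cact C g) z).
Proof. by apply: val_inj; rewrite /= cact_comp. Qed.

Definition cocycle_sset1 n : sset1 :=
  @SSet1 (fun s => cocycle (C s) n) (fun s t f => cocycle_map (cact C f))
    (@cocycle_act_id n) (@cocycle_act_comp n).

Section Hom.
Variables (K : sset1) (k : nat).

Definition hom := smap1 K (degree_sset1 k).
HB.instance Definition _ := gen_eqMixin hom.
HB.instance Definition _ := gen_choiceMixin hom.

Fact hom_zero_subproof s t (f : jmap s t) (x : K t) :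
  (0 : C s k) = cact C f k 0.
Proof. by rewrite linear0. Qed.
Definition hom_zero : hom := @SMap1 K (degree_sset1 k) _ hom_zero_subproof.

Fact hom_opp_subproof (u : hom) s t (f : jmap s t) (x : K t) :
  - (u s (act1 f x) : C s k) = cact C f k (- u t x).
Proof. by rewrite linearN smap1_act. Qed.
Definition hom_opp (u : hom) : hom :=
  @SMap1 K (degree_sset1 k) _ (hom_opp_subproof u).

Fact hom_add_subproof (u v : hom) s t (f : jmap s t) (x : K t) :
  (u s (act1 f x) : C s k) + v s (act1 f x) = cact C f k ((u t x : C t k) + v t x).
Proof. by rewrite linearD !smap1_act. Qed.
Definition hom_add (u v : hom) : hom :=
  @SMap1 K (degree_sset1 k) _ (hom_add_subproof u v).

Fact hom_scale_subproof a (u : hom) s t (f : jmap s t) (x : K t) :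
  a *: (u s (act1 f x) : C s k) = cact C f k (a *: (u t x : C t k)).
Proof. by rewrite linearZ smap1_act. Qed.
Definition hom_scale a (u : hom) : hom :=
  @SMap1 K (degree_sset1 k) _ (hom_scale_subproof a u).

Fact hom_addA : associative hom_add.
Proof. by move=> u v w; apply: smap1_ext => s x; exact: addrA. Qed.
Fact hom_addC : commutative hom_add.
Proof. by move=> u v; apply: smap1_ext => s x; exact: addrC. Qed.
Fact hom_add0 : left_id hom_zero hom_add.
Proof. by move=> u; apply: smap1_ext => s x; exact: add0r. Qed.
Fact hom_addN : left_inverse hom_zero hom_opp hom_add.
Proof. by move=> u; apply: smap1_ext => s x; exact: addNr. Qed.
HB.instance Definition _ :=
  GRing.isZmodule.Build hom hom_addA hom_addC hom_add0 hom_addN.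

Fact hom_scaleA a b u : hom_scale a (hom_scale b u) = hom_scale (a * b) u.
Proof. by apply: smap1_ext => s x; exact: scalerA. Qed.
Fact hom_scale1 : left_id 1 hom_scale.
Proof. by move=> u; apply: smap1_ext => s x; exact: scale1r. Qed.
Fact hom_scaleDr : right_distributive hom_scale +%R.
Proof. by move=> a u v; apply: smap1_ext => s x; exact: scalerDr. Qed.
Fact hom_scaleDl u : {morph hom_scale^~ u : a b / a + b}.
Proof. by move=> a b; apply: smap1_ext => s x; exact: scalerDl. Qed.
HB.instance Definition _ := GRing.Zmodule_isLmodule.Build R hom
  hom_scaleA hom_scale1 hom_scaleDr hom_scaleDl.

Fact hom_diff_subproof (u : hom) s t (f : jmap s t) (x : K t) :
  diff (C s) k (u s (act1 f x)) = cact C f k.+1 (diff (C t) k (u t x)).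
Proof. by rewrite cappd smap1_act. Qed.

End Hom.

Definition hom_diff K k (u : hom K k) : hom K k.+1 :=
  @SMap1 K (degree_sset1 k.+1) _ (hom_diff_subproof u).

Fact hom_diff_linear K k : linear (@hom_diff K k).
Proof. by move=> a u v; apply: smap1_ext => s x; exact: linearP. Qed.
HB.instance Definition _ K k :=
  GRing.isLinear.Build R _ _ _ (@hom_diff K k) (@hom_diff_linear K k).

Fact hom_diffK K k (u : hom K k) : hom_diff (hom_diff u) = 0.
Proof. by apply: smap1_ext => s x; exact: diffK. Qed.

Definition hom_complex K : complex R :=
  @Complex R (hom K) (fun k => @hom_diff K k) (@hom_diffK K).

Section HomMap.
Variables (K L : sset1) (u : smap1 K L).

Definition hom_pull k (w : hom L k) : hom K k := smap1_comp w u.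

Fact hom_pull_linear k : linear (@hom_pull k).
Proof. by move=> a v w; apply: smap1_ext. Qed.
HB.instance Definition _ k :=
  GRing.isLinear.Build R _ _ _ (@hom_pull k) (@hom_pull_linear k).

Fact hom_pull_diff k (w : hom L k) : hom_pull (hom_diff w) = hom_diff (hom_pull w).
Proof. exact: smap1_ext. Qed.

Definition hom_complex_map : cmap (hom_complex L) (hom_complex K) :=
  @CMap R (hom_complex L) (hom_complex K) (fun k => @hom_pull k) hom_pull_diff.

End HomMap.
End Fixed.
End ComplexPresheaves.

(* A perversity on [1] is determined by its value at 0, as its value at 1
   is 0. *)
Definition perversity := \bar int.

Definition zero_perversity : perversity := 0%E.

Section Bicochains.
Variables (R : pzRingType) (X Y : sset).

Record bisimplex := Bisimplex {
  bidim1 : nat;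
  bidim2 : nat;
  bisimp1 : X bidim1;
  bisimp2 : Y bidim2 }.

(* A tensor a (x) b of normalized cochains of degrees i and j is the function
   (s, t) |-> a s * b t, which vanishes outside the bidegree (i, j).  When X
   and Y are standard simplices, this identifies the degree k part of
   N^*(X) (x) N^*(Y) with the functions satisfying the two conditions below;
   the non-degenerate pairs of total degree k index the basis. *)
Definition binormalized (w : bisimplex -> R^o) := forall b,
  degenerate (bisimp1 b) \/ degenerate (bisimp2 b) -> w b = 0.

Definition homogeneous (k : nat) (w : bisimplex -> R^o) := forall b,
  (bidim1 b + bidim2 b)%N != k -> w b = 0.

Definition gcob (Z : sset) (c : forall i, Z i -> R^o) i : Z i -> R^o :=
  match i with
  | 0 => fun _ => 0
  | j.+1 => cob (c j)
  end.

Lemma gcob_linear (Z : sset) a (c d : forall i, Z i -> R^o) i x :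
  @gcob Z (fun i x => a *: c i x + d i x) i x = a *: gcob c x + gcob d x.
Proof.
case: i x => [|i] x /=; first by rewrite scaler0 addr0.
have := cob_linear a (c i) (d i); exact: (congr1 (fun f => f x)).
Qed.

Lemma gcob_gcob (Z : sset) (c : forall i, Z i -> R^o) i (x : Z i) :
  gcob (fun i => @gcob Z c i) x = 0.
Proof.
case: i x => [|[|i]] x //=; last by rewrite cob_cob.
by rewrite /cob big1 // => l _; rewrite scaler0.
Qed.

Lemma gcob_normalized (Z : sset) (c : forall i, Z i -> R^o) :
  (forall i, normalized (c i)) -> forall i, normalized (@gcob Z c i).
Proof. by move=> nc [|i] // x dx; apply: normalized_cob dx. Qed.

(* delta (a (x) b) = delta a (x) b + (-1)^|a| a (x) delta b *)
Definition bicob (w : bisimplex -> R^o) : bisimplex -> R^o := fun b =>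
  let: Bisimplex i j s t := b in
  gcob (fun i' s' => w (Bisimplex s' t)) s +
  (-1) ^+ i *: gcob (fun j' t' => w (Bisimplex s t')) t.

Lemma bicob_linear : linear bicob.
Proof.
move=> a v w; apply/funext => -[i j s t].
rewrite lfunE /= !gcob_linear !scalerDr !scalerA addrACA.
by rewrite commr_sign.
Qed.
HB.instance Definition _ := GRing.isLinear.Build R _ _ _ bicob bicob_linear.

Let dh w (b : bisimplex) : R^o := gcob (fun i s => w (Bisimplex s (bisimp2 b))) (bisimp1 b).
Let dv w (b : bisimplex) : R^o := gcob (fun j t => w (Bisimplex (bisimp1 b) t)) (bisimp2 b).

Let bicobE w b : bicob w b = dh w b + (-1) ^+ bidim1 b *: dv w b.
Proof. by case: b. Qed.

Let dh_dv w b : dh (dv w) b = dv (dh w) b.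
Proof.
case: b => [[|i] j s t]; rewrite /dh /dv /=.
  case: j t => [|j] t //=; rewrite /cob big1 // => l _; exact: scaler0.
case: j t => [|j] t /=; first by rewrite /cob big1 // => l _; exact: scaler0.
rewrite /cob; under eq_bigr do rewrite scaler_sumr.
rewrite exchange_big; apply: eq_bigr => l _; rewrite scaler_sumr; apply: eq_bigr => m _.
by rewrite !scalerA -!exprD addnC.
Qed.

Let dh_sign w b : dh (fun b => (-1) ^+ bidim1 b *: w b) b = - ((-1) ^+ bidim1 b *: dh w b).
Proof.
case: b => [[|i] j s t]; rewrite /dh /= ?scaler0 ?oppr0 //.
rewrite /cob exprS -scalerA scaleN1r opprK scaler_sumr; apply: eq_bigr => l _.
by rewrite !scalerA -!exprD addnC.
Qed.

Let dv_sign w b : dv (fun b => (-1) ^+ bidim1 b *: w b) b = (-1) ^+ bidim1 b *: dv w b.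
Proof.
case: b => [i [|j] s t]; rewrite /dv /= ?scaler0 //.
rewrite /cob scaler_sumr; apply: eq_bigr => l _.
by rewrite !scalerA -!exprD addnC.
Qed.

Let dhD v w b : dh (fun b => v b + w b) b = dh v b + dh w b.
Proof.
rewrite -[dh v b]scale1r -gcob_linear /dh; apply: (congr1 (fun c => @gcob X c _ _)).
by apply: functional_extensionality_dep => i; apply/funext => s; rewrite scale1r.
Qed.

Let dvD v w b : dv (fun b => v b + w b) b = dv v b + dv w b.
Proof.
rewrite -[dv v b]scale1r -gcob_linear /dv; apply: (congr1 (fun c => @gcob Y c _ _)).
by apply: functional_extensionality_dep => i; apply/funext => s; rewrite scale1r.
Qed.

Lemma bicob_bicob w : bicob (bicob w) = 0.
Proof.
have bicobF : bicob w = (fun b => dh w b + (-1) ^+ bidim1 b *: dv w b).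
  by apply/funext => b; rewrite bicobE.
apply/funext => b; rewrite bicobE bicobF dhD dvD dh_sign dv_sign dh_dv.
have -> : dh (dh w) b = 0.
  exact: (@gcob_gcob X (fun i s => w (Bisimplex s (bisimp2 b)))).
have -> : dv (dv w) b = 0.
  exact: (@gcob_gcob Y (fun j t => w (Bisimplex (bisimp1 b) t))).
by rewrite scaler0 addr0 add0r addNr.
Qed.

Lemma bicob_normalized w : binormalized w -> binormalized (bicob w).
Proof.
move=> nw [i j s t] /= dst.
have -> : gcob (fun i s => w (Bisimplex s t)) s = 0.
  case: dst => [ds|dt].
    by apply: gcob_normalized ds => i' s' ds'; apply: nw; left.
  by case: i s => [|i] s //=; rewrite /cob big1 // => l _; rewrite nw ?scaler0 //; right.
have -> : gcob (fun j t => w (Bisimplex s t)) t = 0.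
  case: dst => [ds|dt]; last first.
    by apply: gcob_normalized dt => j' t' dt'; apply: nw; right.
  by case: j t => [|j] t //=; rewrite /cob big1 // => l _; rewrite nw ?scaler0 //; left.
by rewrite scaler0 addr0.
Qed.

Lemma bicob_homogeneous k w : homogeneous k w -> homogeneous k.+1 (bicob w).
Proof.
move=> hw [i j s t] /= ijk.
have -> : gcob (fun i s => w (Bisimplex s t)) s = 0.
  case: i s ijk => [|i] s //= ijk; rewrite /cob big1 // => l _.
  by rewrite hw ?scaler0 //= -eqSS -addSn.
have -> : gcob (fun j t => w (Bisimplex s t)) t = 0.
  case: j t ijk => [|j] t //= ijk; rewrite /cob big1 // => l _.
  by rewrite hw ?scaler0 //= -eqSS -addnS.
by rewrite scaler0 addr0.
Qed.

End Bicochains.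

Arguments Bisimplex {X Y bidim1 bidim2} bisimp1 bisimp2.

Section BisimplexMap.
Variables (X X' Y Y' : sset) (u : smap X X') (v : smap Y Y').

Definition bimap (b : bisimplex X Y) : bisimplex X' Y' :=
  Bisimplex (u _ (bisimp1 b)) (v _ (bisimp2 b)).

Lemma bicob_bimap (R : pzRingType) (w : bisimplex X' Y' -> R^o) :
  bicob (fun b => w (bimap b)) = (fun b => bicob w (bimap b)).
Proof.
apply/funext => -[i j s t]; rewrite /bimap /=; congr (_ + _ *: _).
  by case: i s => [|i] s //=; apply: eq_bigr => l _; rewrite smap_act.
by case: j t => [|j] t //=; apply: eq_bigr => l _; rewrite smap_act.
Qed.

End BisimplexMap.

Section BlownUp.
Variables (R : pzRingType) (p : perversity).

Section Simplex.
Variable s : jsimplex.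

(* The cone on Delta[a] has the apex as last vertex.  A cell is a pair of
   simplices; the face (F_0, 1) is the one that contains the apex.  If s is not
   regular, that is, if [nv1 s = 0], then there are no cells and the modules
   below are zero. *)
Definition cell := bisimplex (standard (nv0 s).+1) (standard (nv1 s)).

Definition has_apex (b : cell) :=
  [exists i, (bisimp1 b : mono _ (nv0 s).+1) i == ord_max].

Definition cell_degree (b : cell) : \bar int :=
  if has_apex b then -oo%E else (Posz (bidim2 b))%:E.

(* The perverse degree, the maximum of [cell_degree] over the terms of [w] with
   non-zero coefficient, is at most [p]. *)
Definition perverse_le (w : cell -> R^o) :=
  forall b, w b != 0 -> (cell_degree b <= p)%E.

Definition blown_up (k : nat) (w : cell -> R^o) :=
  [/\ binormalized w, homogeneous k w, perverse_le w & perverse_le (bicob w)].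

Definition is_blown_up k : {pred cell -> R^o} := fun w => `[< blown_up k w >].

Fact perverse_le_linear a v w :
  perverse_le v -> perverse_le w -> perverse_le (a *: v + w).
Proof.
move=> pv pw b; rewrite lfunE => nz.
have [vb|/pv //] := eqVneq (v b) 0; apply: pw.
by apply: contraNneq nz => ->; rewrite vb scaler0 addr0.
Qed.

Fact perverse_le0 : perverse_le 0.
Proof. by move=> b /eqP. Qed.

Fact is_blown_up_submod k : submod_closed (is_blown_up k).
Proof.
split=> [|a v w]; rewrite !unfold_in.
  by apply/asboolP; split=> //; rewrite ?linear0; exact: perverse_le0.
move=> /asboolP[nv hv pv dv] /asboolP[nw hw pw dw]; apply/asboolP; split.
- by move=> b db; rewrite lfunE nv ?nw // scaler0 addr0.
- by move=> b hb; rewrite lfunE hv ?hw // scaler0 addr0.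
- exact: perverse_le_linear.
- by rewrite linearP; exact: perverse_le_linear.
Qed.
HB.instance Definition _ k := GRing.isSubmodClosed.Build R (cell -> R^o)
  (is_blown_up k) (is_blown_up_submod k).

Definition blowup k := {w : cell -> R^o | w \in is_blown_up k}.
HB.instance Definition _ k := SubChoice.on (blowup k).
HB.instance Definition _ k := [SubChoice_isSubLmodule of blowup k by <:].

Fact blowup_diff_subproof k (w : blowup k) : bicob (val w) \in is_blown_up k.+1.
Proof.
have /asboolP[nw hw pw dw] := valP w; rewrite unfold_in; apply/asboolP; split=> //.
- exact: bicob_normalized.
- exact: bicob_homogeneous.
- by rewrite bicob_bicob; exact: perverse_le0.
Qed.

Definition blowup_diff k (w : blowup k) : blowup k.+1 :=
  Sub (bicob (val w)) (blowup_diff_subproof w).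

Fact blowup_diff_linear k : linear (@blowup_diff k).
Proof. by move=> a v w; apply: val_inj; rewrite /= !linearP. Qed.
HB.instance Definition _ k :=
  GRing.isLinear.Build R _ _ _ (@blowup_diff k) (@blowup_diff_linear k).

Fact blowup_diffK k (w : blowup k) : blowup_diff (blowup_diff w) = 0.
Proof. by apply: val_inj; exact: bicob_bicob. Qed.

Definition blowup_complex : complex R :=
  @Complex R blowup (fun k => @blowup_diff k) blowup_diffK.

End Simplex.

Arguments is_blown_up : clear implicits.

Section Restriction.
Variables (s t : jsimplex) (f : jmap s t).

(* If [nv0 s = 0], this restricts along the inclusion of the apex. *)
Definition cell_map : cell s -> cell t :=
  bimap (standard_map (cone (jmap0 f))) (standard_map (jmap1 f)).

Fact has_apex_cell_map b : has_apex (cell_map b) = has_apex b.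
Proof. by apply: eq_existsb => i; rewrite /= cone_fun_eq_max. Qed.

Fact perverse_le_cell_map (w : cell t -> R^o) :
  perverse_le w -> perverse_le (fun b => w (cell_map b)).
Proof. by move=> pw b /pw; rewrite /cell_degree has_apex_cell_map. Qed.

Fact blowup_map_subproof k (w : blowup t k) :
  (fun b => val w (cell_map b)) \in is_blown_up s k.
Proof.
have /asboolP[nw hw pw dw] := valP w; rewrite unfold_in; apply/asboolP; split.
- move=> b db; apply: nw.
  by case: db => db; [left|right]; apply: smap_degenerate.
- by move=> b hb; apply: hw.
- exact: perverse_le_cell_map.
- by rewrite bicob_bimap; exact: perverse_le_cell_map.
Qed.

Definition blowup_map k (w : blowup t k) : blowup s k :=
  Sub (fun b => val w (cell_map b)) (blowup_map_subproof w).

Fact blowup_map_linear k : linear (@blowup_map k).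
Proof. by move=> a v w; apply: val_inj. Qed.
HB.instance Definition _ k :=
  GRing.isLinear.Build R _ _ _ (@blowup_map k) (@blowup_map_linear k).

Fact blowup_map_diff k (w : blowup t k) :
  blowup_map (blowup_diff w) = blowup_diff (blowup_map w).
Proof. by apply: val_inj; rewrite /= bicob_bimap. Qed.

Definition blowup_complex_map : cmap (blowup_complex t) (blowup_complex s) :=
  @CMap R (blowup_complex t) (blowup_complex s) (fun k => @blowup_map k)
    blowup_map_diff.

End Restriction.

Fact blowup_map_id s k (w : blowup s k) : blowup_map (jmap_id s) w = w.
Proof.
apply: val_inj; apply/funext => -[i j x y] /=; congr (val w _).
by rewrite /cell_map /bimap /= cone_id !mono_idcomp.
Qed.

Fact blowup_map_comp s t u (g : jmap t u) (f : jmap s t) k (w : blowup u k) :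
  blowup_map (jmap_comp g f) w = blowup_map f (blowup_map g w).
Proof.
apply: val_inj; apply/funext => -[i j x y] /=; congr (val w _).
by rewrite /cell_map /bimap /= cone_comp !mono_compA.
Qed.

Definition blowup_presheaf : cpresheaf R :=
  @CPresheaf R blowup_complex blowup_complex_map blowup_map_id blowup_map_comp.

End BlownUp.

Section BlownUpCohomology.
Variables (R : pzRingType) (p : perversity).

Definition blowup_cochains (K : sset1) : complex R :=
  hom_complex (blowup_presheaf R p) K.

Definition blowup_cohomology (k : nat) (K : sset1) : lmodType R :=
  cohomology (blowup_cochains K) k.

Definition blowup_cohomology_map k K L (u : smap1 K L) :
    {linear blowup_cohomology k L -> blowup_cohomology k K} :=
  cohomology_map (hom_complex_map (blowup_presheaf R p) u).

End BlownUpCohomology.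

Arguments blowup_cohomology_map {R} p k {K L} u.

Definition EM_sset1 (R : pzRingType) (n : nat) : sset1 :=
  cocycle_sset1 (blowup_presheaf R zero_perversity) n.

Section Nat.
Variables (R : comPzRingType) (q : perversity) (n : nat) (p : perversity) (k : nat).

(* No additivity is required of the components. *)
Record nat_trans := NatTrans {
  nat_app :> forall K : sset1, blowup_cohomology R q n K -> blowup_cohomology R p k K;
  nat_natural : forall K L (u : smap1 K L) x,
    nat_app (blowup_cohomology_map q n u x) =
    blowup_cohomology_map p k u (nat_app x) }.

Lemma nat_trans_ext (S T : nat_trans) : (forall K, S K =1 T K) -> S = T.
Proof.
case: S T => [S hS] [T hT] /= ST.
have {}ST : S = T.
  by apply: functional_extensionality_dep => K; apply: funext => x; exact: ST.
by rewrite ST in hS *; congr NatTrans; exact: Prop_irrelevance.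
Qed.

(* The R-module structure of the target makes [nat_trans] an R-module. *)
Fact nat_add_subproof (S T : nat_trans) K L (u : smap1 K L) x :
  S K (blowup_cohomology_map q n u x) + T K (blowup_cohomology_map q n u x) =
  blowup_cohomology_map p k u (S L x + T L x).
Proof. by rewrite linearD !nat_natural. Qed.
Definition nat_add (S T : nat_trans) : nat_trans := NatTrans (nat_add_subproof S T).

Fact nat_scale_subproof (a : R) (S : nat_trans) K L (u : smap1 K L) x :
  a *: S K (blowup_cohomology_map q n u x) =
  blowup_cohomology_map p k u (a *: S L x).
Proof. by rewrite linearZ nat_natural. Qed.
Definition nat_scale a (S : nat_trans) : nat_trans := NatTrans (nat_scale_subproof a S).

End Nat.

(* Main.v *)
(** For a simplicial set X let J X be the object over [1] whose simplices over a
regular Delta[a] * Delta[b] are the simplices of X of dimension a + b + 1.  A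
blown-up cochain on J X is a family of cochains [th] on X indexed by the position
of the cut between the vertices over 0 and those over 1, together with a second
family [et] for the cells without apex.  A prism operator [fS], moving vertices
across the cut one at a time, shows that restriction to the cut at 0 identifies
the blown-up cohomology of J X, for every positive perversity, with the ordinary
cohomology of X.

In perversity 0, blown-up cochains of a regular simplex are the normalized
cochains of the underlying simplex, so that K(R, n, [1], 0) is isomorphic to
J K(R, n), and likewise for all cochains of a given degree.  Cohomologous
cocycles therefore have classifying maps that factor through two maps
J (K(R, n) x C^(n-1)) -> J K(R, n), namely (z, y) |-> z and
(z, y) |-> z + delta y; they are homotopic, hence agree in cohomology by the first
part.  The theorem is then the Yoneda lemma. *)

Require Import Defs.
From mathcomp Require Import all_boot all_order all_algebra.
From mathcomp Require Import boolp classical_sets functions constructive_ereal.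
From mathcomp Require Import zify.
From HB Require Import structures.

Set Implicit Arguments.
Unset Strict Implicit.
Unset Printing Implicit Defensive.

Import Order.TTheory GRing.Theory Num.Theory.
Local Open Scope ring_scope.

(** * Monotone maps as functions on natural numbers *)

(** Dropping the apex, a cell of degree k with apex spans a simplex of dimension k, while a cell of
    degree k without apex spans one of dimension k + 1; hence [et] lives one dimension above [th].
    Two features of the cut shape the proof. The prism operator evaluates a family on degeneracies
    that repeat a vertex across the cut, exactly those on which a blown-up cochain need not vanish,
    so families are normalized only away from the cut. And the prism formula holds for families
    defined at all cuts, whereas a simplex lying entirely over 0 is not regular and carries no cell.
    Setting a family to 0 at that last cut destroys one face of the coboundary, the one that omits
    the only vertex over 1. The lost term has to be stored in [et] (this is [flast]); it sits on
    cells whose factor over 1 is a vertex, of perverse degree 0, and there positivity of the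
    perversity enters. Finally, a cut of a k-simplex is a k-simplex of Delta[1], so the same prism
    formula also gives the ordinary homotopy invariance used for classifying maps. *)

Definition ev m n (f : mono m n) (q : nat) : nat :=
  oapp (fun i : 'I_m => f i : nat) 0%N (insub q).

Lemma ev_ord m n (f : mono m n) (i : 'I_m) : ev f i = f i.
Proof. by rewrite /ev valK. Qed.

Lemma ev_ext m n (f g : mono m n) : (forall q, (q < m)%N -> ev f q = ev g q) -> f = g.
Proof.
by move=> fg; apply: mono_ext => i; apply: val_inj; rewrite /= -!ev_ord fg.
Qed.

Lemma ev_lt m n (f : mono m n) q : (q < m)%N -> (ev f q < n)%N.
Proof. by move=> qm; rewrite (ev_ord f (Ordinal qm)). Qed.

Lemma ev_le m n (f : mono m n) q r : (q <= r)%N -> (r < m)%N -> (ev f q <= ev f r)%N.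
Proof.
move=> qr rm; have qm := leq_ltn_trans qr rm.
by rewrite (ev_ord f (Ordinal qm)) (ev_ord f (Ordinal rm)); apply: monoP.
Qed.

Lemma ev_id m q : (q < m)%N -> ev (mono_id m) q = q.
Proof. by move=> qm; rewrite (ev_ord _ (Ordinal qm)). Qed.

Lemma ev_comp m n p (g : mono n p) (f : mono m n) q :
  (q < m)%N -> ev (mono_comp g f) q = ev g (ev f q).
Proof. by move=> qm; rewrite !(ev_ord _ (Ordinal qm)) /= ev_ord. Qed.

Lemma ev_face m (l : 'I_m.+1) q : (q < m)%N -> ev (face l) q = bump l q.
Proof. by move=> qm; rewrite (ev_ord _ (Ordinal qm)). Qed.

Lemma ev_cone m n (f : mono m n) q : (q < m)%N -> ev (cone f) q = ev f q.
Proof.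
move=> qm; rewrite [RHS](ev_ord _ (Ordinal qm)).
rewrite [X in ev _ X](_ : q = lift ord_max (Ordinal qm)); last by rewrite lift_max.
by rewrite ev_ord /= cone_fun_lift lift_max.
Qed.

Lemma ev_cone_max m n (f : mono m n) : ev (cone f) m = n.
Proof. by rewrite (ev_ord _ (ord_max : 'I_m.+1)) /= cone_fun_max. Qed.

(** Monotone maps are given by formulas on numbers, meaningful only below [m], so that identities
    between composites reduce to linear arithmetic. *)
Definition ok m n (F : nat -> nat) :=
  (forall q r, (q <= r)%N -> (r < m)%N -> (F q <= F r)%N) /\
  (forall q, (q < m)%N -> (F q < n)%N).

Lemma ok_ev m n (f : mono m n) : ok m n (ev f).
Proof. by split=> [q r|q]; [exact: ev_le|exact: ev_lt]. Qed.

Lemma ok_mono m n F : ok m n F ->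
  exists f : mono m n, forall q, (q < m)%N -> ev f q = F q.
Proof.
move=> [Fle Flt]; have h (i j : 'I_m) : (i <= j)%N ->
    (Ordinal (Flt i (ltn_ord i)) <= Ordinal (Flt j (ltn_ord j)))%N.
  by move=> ij; apply: Fle.
by exists (Mono h) => q qm; rewrite (ev_ord _ (Ordinal qm)).
Qed.

(* The running maximum makes [mk] total: no proof of monotonicity or
   boundedness appears in the terms, only in [ev_mk]. *)
Definition mk_fun m n (F : nat -> nat) (i : 'I_m) : 'I_n.+1 :=
  inord (minn (\max_(j < i.+1) F j) n).

Fact mk_subproof m n F : {homo @mk_fun m n F : i j / (i <= j)%N}.
Proof.
move=> i j ij; rewrite /mk_fun !inordK ?ltnS ?geq_minr //.
rewrite leq_min geq_minr andbT geq_min; apply/orP; left.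
by apply/bigmax_leqP => q _; exact: (leq_bigmax (widen_ord (ij : (i.+1 <= j.+1)%N) q)).
Qed.

Definition mk m n F : mono m n.+1 := Mono (@mk_subproof m n F).

Lemma ev_mk m n F q : ok m n.+1 F -> (q < m)%N -> ev (mk m n F) q = F q.
Proof.
move=> [Fle Flt] qm; rewrite (ev_ord _ (Ordinal qm)) /= /mk_fun.
rewrite inordK ?ltnS ?geq_minr //=; have Fn := Flt _ qm.
suff -> : \max_(j < q.+1) F j = F q by apply/minn_idPl.
apply/eqP; rewrite eqn_leq (leq_bigmax (ord_max : 'I_q.+1)) andbT.
by apply/bigmax_leqP => j _; apply: Fle; rewrite // -ltnS.
Qed.

Lemma ev_mk_eq m n F (f : mono m n.+1) :
  (forall q, (q < m)%N -> F q = ev f q) -> mk m n F = f.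
Proof.
move=> Ff; apply: ev_ext => q qm; rewrite ev_mk ?Ff //; split=> [r t rt tm|r rm].
  by rewrite !Ff ?(leq_ltn_trans rt) // ev_le.
by rewrite Ff // ev_lt.
Qed.

Lemma eq_mk m n F G : (forall q, (q < m)%N -> F q = G q) -> mk m n F = mk m n G.
Proof.
move=> FG; apply: mono_ext => i /=; rewrite /mk_fun; congr (inord (minn _ _)).
by apply: eq_bigr => j _; apply: FG; apply: leq_trans (ltn_ord i); apply: ltn_ord.
Qed.

Lemma mk_id m : mk m.+1 m id = mono_id m.+1.
Proof. by apply: ev_mk_eq => q qm; rewrite ev_id. Qed.

Lemma mono_comp_mk m n p F G : ok m n.+1 F -> ok n.+1 p.+1 G ->
  mono_comp (mk n.+1 p G) (mk m n F) = mk m p (fun q => G (F q)).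
Proof.
move=> okF okG; apply: esym; apply: ev_mk_eq => q qm.
by rewrite ev_comp // !ev_mk //; apply: okF.2.
Qed.

Lemma act_mk (X : sset) m n p F G (x : X p) : ok m.+1 n.+1 F -> ok n.+1 p.+1 G ->
  act (mk m.+1 n F) (act (mk n.+1 p G) x) = act (mk m.+1 p (fun q => G (F q))) x.
Proof. by move=> okF okG; rewrite -act_comp mono_comp_mk. Qed.

Lemma ok_bump m q : ok m m.+1 (bump q).
Proof. by split; rewrite /bump; lia. Qed.

Lemma ok_unbump m l : (l < m)%N -> ok m.+1 m (unbump l).
Proof. by move=> lm; split; rewrite /unbump; lia. Qed.

Lemma face_mk m (l : 'I_m.+1) : face l = mk m m (bump l).
Proof. by apply/esym; apply: ev_mk_eq => q qm; rewrite ev_face. Qed.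

(** * Simplicial identities *)

Section FacesDegeneracies.
Variable X : sset.

Definition dq k q (x : X k.+1) : X k := act (mk k.+1 k.+1 (bump q)) x.

Definition sq k l (x : X k) : X k.+1 := act (mk k.+2 k (unbump l)) x.

Lemma dq_dq k q r (x : X k.+2) : (q <= r)%N -> dq r (dq q x) = dq q (dq r.+1 x).
Proof.
move=> qr; rewrite /dq !act_mk; try exact: ok_bump.
by congr (act _ x); apply: eq_mk => t _; rewrite /bump; lia.
Qed.

Lemma dq_sq_lt k q l (x : X k.+1) : (q <= l)%N -> (l <= k)%N ->
  dq q (sq l.+1 x) = sq l (dq q x).
Proof.
move=> ql lk; rewrite /dq /sq !act_mk; try exact: ok_bump; try exact: ok_unbump.
by congr (act _ x); apply: eq_mk => t _; rewrite /bump /unbump; lia.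
Qed.

Lemma dq_sq_gt k q l (x : X k.+1) : (l < q)%N -> (l <= k)%N ->
  dq q.+1 (sq l x) = sq l (dq q x).
Proof.
move=> ql lk; rewrite /dq /sq !act_mk; try exact: ok_bump; try by apply: ok_unbump; lia.
by congr (act _ x); apply: eq_mk => t _; rewrite /bump /unbump; lia.
Qed.

Lemma dq_sq_id k q l (x : X k) : (l <= q <= l.+1)%N -> (l <= k)%N -> dq q (sq l x) = x.
Proof.
move=> ql lk; rewrite /dq /sq act_mk; [|exact: ok_bump|exact: ok_unbump].
rewrite -[RHS]act_id -mk_id.
by congr (act _ x); apply: eq_mk => t _; rewrite /bump /unbump; lia.
Qed.

End FacesDegeneracies.

(** * Families of cochains indexed by a cut *)

Section Families.
Variables (R : pzRingType) (X : sset).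

(* [th a x] is the value on the simplex [x] whose first [a] vertices are placed
   over 0 and whose other vertices are placed over 1. *)
Definition fam k := nat -> X k -> R^o.

(** Omitting a vertex over 0, that is [q < a], leaves one vertex fewer before the cut. *)
Definition fD k (th : fam k) : fam k.+1 := fun a x =>
  \sum_(0 <= q < k.+2) (-1) ^+ q *: th (a - (q < a))%N (dq q x).

(* The prism operator, which moves the vertices from 0 to 1 one at a time. *)
Definition fS k (th : fam k.+1) : fam k := fun a x =>
  \sum_(0 <= l < a) (-1) ^+ l *: th l.+1 (sq l x).

Lemma fS_recr k (th : fam k.+1) a x :
  fS th a.+1 x = fS th a x + (-1) ^+ a *: th a.+1 (sq a x).
Proof. by rewrite /fS big_nat_recr. Qed.

Lemma fS0 k (th : fam k.+1) x : fS th 0 x = 0.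
Proof. by rewrite /fS big_geq. Qed.

Lemma eq_fD k (th th' : fam k) a (x : X k.+1) :
  (forall b, (b <= a)%N -> (a <= b.+1)%N -> th b =1 th' b) -> fD th a x = fD th' a x.
Proof.
by move=> e; apply: eq_big_nat => q _; congr (_ *: _); apply: e; lia.
Qed.

Lemma eq_fS k (th th' : fam k.+1) a x :
  (forall b, (0 < b <= a)%N -> th b =1 th' b) -> fS th a x = fS th' a x.
Proof. by move=> e; apply: eq_big_nat => l la; congr (_ *: _); apply: e; lia. Qed.

Lemma fDB k (th th' : fam k) a x :
  fD (fun a x => th a x - th' a x) a x = fD th a x - fD th' a x.
Proof. by rewrite /fD -sumrB; apply: eq_bigr => q _; rewrite scalerBr. Qed.

Lemma fDD k (th th' : fam k) a x :
  fD (fun a x => th a x + th' a x) a x = fD th a x + fD th' a x.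
Proof. by rewrite /fD -big_split; apply: eq_bigr => q _; rewrite scalerDr. Qed.

Lemma fSN k (th : fam k.+1) a x : fS (fun a x => - th a x) a x = - fS th a x.
Proof. by rewrite /fS -sumrN; apply: eq_bigr => q _; rewrite scalerN. Qed.

Lemma fS_eq0 k (th : fam k.+1) a x :
  (forall b y, (0 < b <= a)%N -> th b y = 0) -> fS th a x = 0.
Proof.
by move=> e; rewrite /fS big_nat big1 // => l la; rewrite e ?scaler0 //; lia.
Qed.

Lemma fD_eq0 k (th : fam k) a x :
  (forall b y, (b <= a)%N -> (a <= b.+1)%N -> th b y = 0) -> fD th a x = 0.
Proof. by move=> e; rewrite /fD big1 // => q _; rewrite e ?scaler0 //; lia. Qed.

Lemma cob_fD k (th : fam k) a : cob (th a) =1 fD (fun _ => th a) 0.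
Proof.
move=> x; rewrite /cob /fD big_mkord; apply: eq_bigr => l _.
by rewrite /dq face_mk.
Qed.

Lemma fD_const k (c : X k -> R^o) a : fD (fun _ => c) a =1 cob c.
Proof. by move=> x; rewrite (cob_fD (fun _ => c) 0). Qed.

(** In the lowest degree [fD (fS th)] would need cochains of degree -1. Only the degeneracy s_0
    occurs, and both of its faces are [x]. *)
Lemma fS_fD_low (th : fam 0) a (x : X 0) : (a <= 1)%N ->
  fS (fD th) a x = th 0%N x - th a x.
Proof.
case: a => [|[|a]] // _; first by rewrite fS0 subrr.
rewrite fS_recr fS0 add0r expr0 scale1r /fD !big_nat_recl // big_geq //=.
by rewrite !dq_sq_id // expr0 scale1r expr1 scaleN1r addr0.
Qed.

(** The homotopy between the identity and restriction to the cut 0, by induction on the cut: passing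
    from [a] to [a.+1] adds one prism. *)
Lemma fS_fD k (th : fam k.+1) a (x : X k.+1) : (a <= k.+2)%N ->
  fS (fD th) a x + fD (fS th) a x = th 0%N x - th a x.
Proof.
elim: a => [|a IHa] ak.
  by rewrite fS0 subrr add0r; apply: fD_eq0 => -[|b] y // _ _; rewrite fS0.
have {}IHa := IHa (ltnW ak).
rewrite fS_recr.
pose G q := (-1) ^+ q *: (fS th (a.+1 - (q < a.+1))%N (dq q x)
  - fS th (a - (q < a))%N (dq q x)).
have -> : fD (fS th) a.+1 x = fD (fS th) a x + \sum_(q < k.+2) G q.
  rewrite /fD !big_mkord -big_split; apply: eq_bigr => q _.
  by rewrite /= /G scalerBr addrCA subrr addr0.
rewrite addrACA IHa.
(* The faces a and a + 1 of s_a x are both [x] and give the right-hand side. [G q] is 0 for q = a;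
   otherwise it is a single summand of [fS], which cancels the remaining face of s_a x by a
   simplicial identity. *)
suff -> : (-1) ^+ a *: fD th a.+1 (sq a x) + \sum_(q < k.+2) G q = th a x - th a.+1 x.
  by rewrite addrA subrK.
rewrite /fD big_mkord (bigD1_ord (Ordinal (leqW ak))) //= scalerDr scalerA.
rewrite -expr2 sqrr_sign scale1r ltnSn subn1 dq_sq_id; [|lia|lia].
rewrite -addrA; congr (_ + _); rewrite scaler_sumr -big_split (bigD1 (Ordinal ak)) //=.
rewrite big1 ?addr0 => [|q]; last first.
  rewrite -val_eqE /= => qa; rewrite scalerA -exprD /G.
  have [qa'|aq] : (q < a)%N \/ (a < q)%N by lia.
    have -> : bump a q = q by rewrite /bump; lia.
    have -> : (a.+1 - (q < a.+1) = a)%N by lia.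
    have -> : (a - (q < a) = a.-1)%N by lia.
    case: a ak {IHa qa G} qa' => // a ak qa'; rewrite fS_recr (addrC (fS _ _ _)) addrK scalerA -exprD.
    rewrite dq_sq_lt; [|lia|lia].
    by rewrite /= addSn exprS addnC mulN1r scaleNr addNr.
  have -> : bump a q = q.+1 by rewrite /bump; lia.
  have -> : (a.+1 - (q < a.+1) = a.+1)%N by lia.
  have -> : (a - (q < a) = a)%N by lia.
  have -> : (a.+1 - (q.+1 < a.+1) = a.+1)%N by lia.
  rewrite fS_recr (addrC (fS _ _ _)) addrK scalerA -exprD.
  rewrite dq_sq_gt; [|lia|have := ltn_ord q; lia].
  by rewrite addnS exprS addnC mulN1r scaleNr addNr.
have -> : bump a a = a.+1 by rewrite /bump; lia.
rewrite /G !ltnn !ltnSn !subn0 !subn1 /= subrr scaler0 addr0.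
rewrite dq_sq_id; [|lia|lia].
by rewrite exprS -scalerA scaleN1r scalerN scalerA -expr2 sqrr_sign scale1r.
Qed.
(* A degeneracy across the cut, [i.+1 = a], is not a degeneracy of the join. *)
Definition bnorm k : fam k -> Prop :=
  if k is k'.+1 return fam k -> Prop then fun th =>
    forall a i (y : X k'), (a <= k)%N -> (i <= k')%N -> i.+1 != a -> th a (sq i y) = 0
  else fun=> True.

Lemma degenerateP k (x : X k) : degenerate x <->
  (if k is k'.+1 return X k -> Prop
   then fun x => exists i (y : X k'), (i <= k')%N /\ x = sq i y else fun=> False) x.
Proof.
split=> [[m [f [y [mk ->]]]]|].
  case: k f mk {x} => // k f mk; have [i fi] := mono_collapses f mk.
  have ik : (i <= k)%N by case: fi => ? [].
  exists i, (act (mono_comp f (face (Ordinal (leqW ik : (i < k.+2)%N)))) y).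
  split=> //; rewrite {1}(collapses_factor ik fi) act_comp; congr (act _ _).
  apply/esym; apply: ev_mk_eq => q qk.
  by rewrite (ev_ord _ (Ordinal qk)).
case: k x => // k x [i [y [ik ->]]].
by exists k, (mk k.+2 k (unbump i)), y.
Qed.

Lemma sq_sq k i l (y : X k) : (l <= i)%N -> (i <= k)%N ->
  sq l (sq i y) = sq i.+1 (sq l y).
Proof.
move=> li ik; rewrite /sq !act_mk; try by apply: ok_unbump; lia.
by congr (act _ y); apply: eq_mk => t _; rewrite /unbump; lia.
Qed.

(** For x = s_i y, exchanging s_l and s_i exhibits s_l x as a degeneracy whose repeated vertices are
    not separated by the cut l + 1. So the weak normalization of [th] yields the full one for
    [fS th]. *)
Lemma fS_normalized k (th : fam k.+1) a : bnorm th -> (a <= k.+1)%N ->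
  normalized (fS th a).
Proof.
move=> nth ak x /degenerateP; case: k th nth ak x => // k th nth ak x [i [y [ik ->]]].
rewrite /fS big_nat big1 // => l la.
have [li|il] := leqP l i; first by rewrite sq_sq // nth ?scaler0 //; lia.
case: l il la => // l il la; rewrite -sq_sq ?nth ?scaler0 //; try lia.
Qed.

Lemma fam_normalized_bnorm k (th : fam k) :
  (forall a, (a <= k.+1)%N -> normalized (th a)) -> bnorm th.
Proof.
case: k th => // k th nth a i y ak ik _; apply: nth; first by apply: leq_trans ak _.
by apply/degenerateP; exists i, y.
Qed.

End Families.

(** * Joins *)

Lemma mono_gt0 m n (f : mono m.+1 n) : (0 < n)%N.
Proof. exact: leq_ltn_trans (leq0n _) (ltn_ord (f ord0)). Qed.

Lemma jmap_gt0 s t (f : jmap s t) : (0 < nv1 s)%N -> (0 < nv1 t)%N.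
Proof. by move=> h; apply: leq_ltn_trans (leq0n _) (ltn_ord (jmap1 f (Ordinal h))). Qed.

Definition jfun n a (f g : nat -> nat) q := if (q < n)%N then f q else (a + g (q - n))%N.

Lemma ok_jfun n m a b N M f g : ok n a f -> ok m b g -> (n + m = N)%N -> (a + b = M)%N ->
  ok N M (jfun n a f g).
Proof.
move=> [fle flt] [gle glt] <- <-; split=> [q r qr rm|q qm]; rewrite /jfun.
  have [rn|nr] := ltnP r n; first by rewrite (leq_ltn_trans qr) // fle.
  have [qn|nq] := ltnP q n; first by have := flt _ qn; lia.
  by rewrite leq_add2l gle; lia.
have [qn|nq] := ltnP q n; first by have := flt _ qn; lia.
by have := glt (q - n)%N; lia.
Qed.

Definition jdim s := (nv0 s + nv1 s).-1.

Lemma jdimE s : (nv0 s + nv1 s = (jdim s).+1)%N.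
Proof. by rewrite prednK ?nv_gt0. Qed.

Definition jjoin s t (f : jmap s t) : mono (jdim s).+1 (jdim t).+1 :=
  mk _ _ (jfun (nv0 s) (nv0 t) (ev (jmap0 f)) (ev (jmap1 f))).

Lemma ok_jjoin s t (f : jmap s t) :
  ok (jdim s).+1 (jdim t).+1 (jfun (nv0 s) (nv0 t) (ev (jmap0 f)) (ev (jmap1 f))).
Proof. exact: ok_jfun (ok_ev _) (ok_ev _) (jdimE s) (jdimE t). Qed.

Lemma jjoin_id s : jjoin (jmap_id s) = mono_id _.
Proof.
apply: ev_mk_eq => q qm; rewrite ev_id // /jfun /=.
have := jdimE s; case: ltnP => qn e; rewrite ev_id //; lia.
Qed.

Lemma jjoin_comp s t r (g : jmap t r) (f : jmap s t) :
  jjoin (jmap_comp g f) = mono_comp (jjoin g) (jjoin f).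
Proof.
rewrite mono_comp_mk; try exact: ok_jjoin; apply: eq_mk => q qm.
have := jdimE s; rewrite /jfun /=; case: ltnP => qn e.
  by rewrite ev_comp // ev_lt.
have qs : (q - nv0 s < nv1 s)%N by lia.
by rewrite ev_comp // ltnNge leq_addr /= addKn.
Qed.

Section Join.
Variable X : sset.

(** A map over [1] out of a regular simplex has a regular target, so a proof of regularity can be
    carried along. Over a non-regular simplex only the empty function remains, matching the single
    element of a zero module. *)
Definition jact s t (f : jmap s t) (x : (0 < nv1 t)%N -> X (jdim t)) :
  (0 < nv1 s)%N -> X (jdim s) := fun h => act (jjoin f) (x (jmap_gt0 f h)).

Fact jact_id s x : jact (jmap_id s) x = x.
Proof.
by apply: funext => h; rewrite /jact jjoin_id act_id; congr x; apply: bool_irrelevance.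
Qed.

Fact jact_comp s t r (g : jmap t r) (f : jmap s t) x :
  jact (jmap_comp g f) x = jact f (jact g x).
Proof.
apply: funext => h; rewrite /jact jjoin_comp act_comp.
by congr (act _ (act _ (x _))); apply: bool_irrelevance.
Qed.

(* The simplices of [J X] over a regular [s] are the simplices of [X] with the
   same vertices; there is exactly one simplex over each non-regular [s]. *)
Definition J : sset1 :=
  @SSet1 (fun s => (0 < nv1 s)%N -> X (jdim s)) jact jact_id jact_comp.

End Join.

Definition Jmap X Y (g : smap X Y) : smap1 (J X) (J Y).
Proof.
refine (@SMap1 (J X) (J Y) (fun s x h => g _ (x h)) _).
by move=> s t f x; apply: funext => h /=; rewrite /jact smap_act.
Defined.

(** * The cells of a join and families of cochains *)

Section Fold.
Variables (R : pzRingType) (X : sset).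

(* The case [ev u i < nv0 s] is that of a simplex [u] without apex; otherwise
   [u] is non-degenerate only if the apex is its last vertex and no other.  With
   the sign in front of [et], the coboundary becomes
   (th, et) |-> (fD th + et, - fD et). *)
Definition foldc k (th : fam R X k) (et : fam R X k.+1) s (x : J X s) (c : cell s) : R^o :=
  let: Bisimplex i j u v := c in
  let y n m := act (mk m.+1 (jdim s) (jfun n (nv0 s) (ev u) (ev v))) (x (mono_gt0 v)) in
  if (i + j != k)%N then 0
  else if (ev u i < nv0 s)%N then (-1) ^+ i.+1 *: et i.+1 (y i.+1 k.+1)
  else if (0 < i)%N && (ev u i.-1 == nv0 s) then 0
  else th i (y i k).

Variables (k : nat) (th : fam R X k) (et : fam R X k.+1).

Lemma ok_jet s i j (u : mono i.+1 (nv0 s).+1) (v : mono j.+1 (nv1 s)) :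
  (ev u i < nv0 s)%N -> (i + j = k)%N ->
  ok k.+2 (jdim s).+1 (jfun i.+1 (nv0 s) (ev u) (ev v)).
Proof.
move=> ui ijk; apply: (@ok_jfun _ j.+1 _ (nv1 s)) (jdimE s); rewrite ?addSn ?addnS ?ijk //.
  split=> q => [r qr ri|qi]; first exact: ev_le.
  by apply: leq_ltn_trans ui; apply: ev_le.
exact: ok_ev.
Qed.

Lemma ok_jth s i j (u : mono i.+1 (nv0 s).+1) (v : mono j.+1 (nv1 s)) :
  ~~ ((0 < i)%N && (ev u i.-1 == nv0 s)) -> (i + j = k)%N ->
  ok k.+1 (jdim s).+1 (jfun i (nv0 s) (ev u) (ev v)).
Proof.
move=> ui ijk; apply: (@ok_jfun _ j.+1 _ (nv1 s)) (jdimE s); rewrite ?addnS ?ijk //.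
  split=> q => [r qr ri|qi]; first by apply: ev_le => //; apply: ltnW.
  have := @ev_lt _ _ u i.-1; have := @ev_le _ _ u q i.-1; lia.
exact: ok_ev.
Qed.

Lemma foldc_map s t (f : jmap s t) (x : J X t) c :
  foldc th et (act1 f x) c = foldc th et x (cell_map f c).
Proof.
case: c => i j u v; rewrite /cell_map /bimap /foldc.
rewrite [act1 _ _]/(jact _ _) /jact.
have evc q : (q < i.+1)%N -> ev (mono_comp (cone (jmap0 f)) u) q =
    if (ev u q < nv0 s)%N then ev (jmap0 f) (ev u q) else nv0 t.
  move=> qi; rewrite ev_comp //; have := ev_lt u qi; rewrite ltnS leq_eqVlt.
  case: eqVneq => [->|_] /= uq; first by rewrite ev_cone_max ltnn.
  by rewrite uq ev_cone.
case: ifP => // /negbFE/eqP ijk; rewrite /= !evc //; last by lia.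
have evl q (h : (q < nv0 s)%N) := ev_lt (jmap0 f) h.
case: ifP => ui; first rewrite evl //.
  congr (_ *: et _ _); rewrite act_mk; [|exact: ok_jet|exact: ok_jjoin].
  rewrite (bool_irrelevance (jmap_gt0 _ _) (mono_gt0 (mono_comp (jmap1 f) v))).
  congr (act _ _); apply: eq_mk => q qk; rewrite /jfun.
  case: (ltnP q i.+1) => qi.
    have uq : (ev u q < nv0 s)%N by apply: leq_ltn_trans ui; apply: ev_le.
    by rewrite evc // uq.
  by rewrite ltnNge leq_addr /= addKn ev_comp //; lia.
rewrite ltnn; case: ifP => ui'.
  have -> // : (0 < i)%N && ((if (ev u i.-1 < nv0 s)%N then ev (jmap0 f) (ev u i.-1)
    else nv0 t) == nv0 t).
  by case/andP: ui' => -> /eqP ->; rewrite ltnn eqxx.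
have -> : (0 < i)%N && ((if (ev u i.-1 < nv0 s)%N then ev (jmap0 f) (ev u i.-1)
    else nv0 t) == nv0 t) = false.
  apply/negbTE; rewrite negb_and -leqNgt; move: ui'.
  case: i u {evc ijk ui} => //= i u /negbT.
  have := @ev_lt _ _ u i; case: (ltnP (ev u i) (nv0 s)) => [h|]; last by lia.
  by have := evl _ h; lia.
congr (th _ _); rewrite act_mk; [|by apply: ok_jth; rewrite ?ui'|exact: ok_jjoin].
rewrite (bool_irrelevance (jmap_gt0 _ _) (mono_gt0 (mono_comp (jmap1 f) v))).
congr (act _ _); apply: eq_mk => q qk; rewrite /jfun.
case: (ltnP q i) => qi.
  have uq : (ev u q < nv0 s)%N.
    have := @ev_lt _ _ u i.-1; have := @ev_le _ _ u q i.-1; lia.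
  by rewrite evc ?uq //; lia.
by rewrite ltnNge leq_addr /= addKn ev_comp //; lia.
Qed.

End Fold.

Lemma jfun_bumpl n a l f f' g q : (l <= n)%N ->
  ((q < n)%N -> f' q = f (bump l q)) -> jfun n a f' g q = jfun n.+1 a f g (bump l q).
Proof.
move=> ln ff; rewrite /jfun; have [qn|nq] := ltnP q n.
  by rewrite ff // (_ : (_ < _)%N = true) //; rewrite /bump; lia.
have -> : bump l q = q.+1 by rewrite /bump; lia.
by rewrite ltnS ltnNge nq.
Qed.

Lemma jfun_bumpr n a m f g g' q : ((n <= q)%N -> g' (q - n)%N = g (bump m (q - n))) ->
  jfun n a f g' q = jfun n a f g (bump (n + m) q).
Proof.
move=> gg; rewrite /jfun; have [qn|nq] := ltnP q n.
  by have -> : bump (n + m) q = q; [rewrite /bump; lia|rewrite qn].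
rewrite gg // (_ : (_ < _)%N = false); last by rewrite /bump; lia.
by congr (a + g _)%N; rewrite /bump; lia.
Qed.

Lemma jfun_unbumpl n a l f f' g q : (l < n)%N ->
  ((q < n.+1)%N -> f' q = f (unbump l q)) -> jfun n.+1 a f' g q = jfun n a f g (unbump l q).
Proof.
move=> ln ff; rewrite /jfun; have [qn|nq] := ltnP q n.+1.
  by rewrite ff // (_ : (_ < _)%N = true) //; rewrite /unbump; lia.
have -> : unbump l q = q.-1 by rewrite /unbump; lia.
by rewrite (_ : (_ < _)%N = false); [congr (a + g _)%N|]; lia.
Qed.

Lemma jfun_unbumpr n a m f g g' q : ((n <= q)%N -> g' (q - n)%N = g (unbump m (q - n))) ->
  jfun n a f g' q = jfun n a f g (unbump (n + m) q).
Proof.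
move=> gg; rewrite /jfun; have [qn|nq] := ltnP q n.
  by have -> : unbump (n + m) q = q; [rewrite /unbump; lia|rewrite qn].
rewrite gg // (_ : (_ < _)%N = false); last by rewrite /unbump; lia.
by congr (a + g _)%N; rewrite /unbump; lia.
Qed.

Lemma standard_degenerate n i (u : standard n i) : degenerate u ->
  exists i' l (u' : mono i'.+1 n), [/\ i = i'.+1, (l <= i')%N &
    forall q, (q < i.+1)%N -> ev u q = ev u' (unbump l q)].
Proof.
move/degenerateP; case: i u => // i u [l [u' [li ->]]]; exists i, l, u'; split=> // q qi.
by rewrite [sq _ _]/(mono_comp _ _) ev_comp // ev_mk //; apply: ok_unbump.
Qed.

Lemma ev_degenerate n i (u : mono i.+1 n) l :
  (l < i)%N -> ev u l = ev u l.+1 -> @degenerate (standard n) i u.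
Proof.
case: n u => [|n] u; first by have := mono_gt0 u.
move=> li ul; rewrite -[u]mono_idcomp.
apply: (@collapses_degenerate (standard n.+1) _ _ u (mono_id _) l).
exists (leqW li), (li : (l.+1 < i.+1)%N); apply: val_inj.
by rewrite /= -!ev_ord.
Qed.

Lemma two_apex_degenerate a i (u : mono i.+1 a.+1) :
  ev u i = a -> (0 < i)%N && (ev u i.-1 == a) -> @degenerate (standard a.+1) i u.
Proof.
case: i u => // i u ui /eqP ui'.
by apply: (ev_degenerate (ltnSn i)); exact: etrans ui' (esym ui).
Qed.

Section FoldDegenerate.
Variables (R : pzRingType) (X : sset) (k : nat) (th : fam R X k) (et : fam R X k.+1).

Lemma foldc_homogeneous s (x : J X s) : homogeneous k (foldc th et x).
Proof. by move=> [i j u v] /= ->. Qed.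

Lemma bnorm_degenerate m (ph : fam R X m) a F (n : nat) (x : X n) l :
  bnorm ph -> (a <= m)%N -> (l < m)%N -> l.+1 != a -> ok m n.+1 F ->
  ph a (act (mk m.+1 n (fun q => F (unbump l q))) x) = 0.
Proof.
case: m ph => // m ph nph am lm la okF.
rewrite -(@act_mk _ m.+1 m n (unbump l) F) //; last exact: ok_unbump.
exact: nph.
Qed.

(** A degeneracy of one factor repeats two vertices on the same side of the cut, where [bnorm]
    applies; a repetition of the apex is sent to 0 by [foldc]. *)
Lemma foldc_binormalized s (x : J X s) :
  bnorm th -> bnorm et -> binormalized (foldc th et x).
Proof.
move=> nth net [i j u v] /= duv; case: eqVneq => //= ijk.
have jk : (j <= k)%N by lia.
case: ifP => ui.
  case: duv => [/standard_degenerate[i' [l [u' [ei li uu]]]]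
               |/standard_degenerate[j' [l [v' [ej lj vv]]]]].
    subst i; rewrite (@eq_mk _ _ _ (fun q => jfun i'.+1 (nv0 s) (ev u') (ev v) (unbump l q))).
      rewrite bnorm_degenerate ?scaler0 //; try lia.
      have u'i : (ev u' i' < nv0 s)%N.
        by move: ui; rewrite uu // (_ : unbump l i'.+1 = i') //; rewrite /unbump; lia.
      apply: (@ok_jfun _ j.+1 _ (nv1 s)) (jdimE s); try lia; last exact: ok_ev.
      split=> q => [r qr ri|qi]; first exact: ev_le.
      by apply: leq_ltn_trans u'i; apply: ev_le.
    by move=> q qk; apply: jfun_unbumpl => // qi; rewrite uu.
  subst j; rewrite (@eq_mk _ _ _ (fun q => jfun i.+1 (nv0 s) (ev u) (ev v') (unbump (i.+1 + l) q))).
    rewrite bnorm_degenerate ?scaler0 //; try lia.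
    apply: (@ok_jfun _ j'.+1 _ (nv1 s)) (jdimE s); try lia; last exact: ok_ev.
    split=> q => [r qr ri|qi]; first exact: ev_le.
    by apply: leq_ltn_trans ui; apply: ev_le.
  by move=> q qk; apply: jfun_unbumpr => qi; rewrite vv //; lia.
case: ifP => // ui'.
have okui : ok i (nv0 s) (ev u).
  split=> q => [r qr ri|qi]; first by apply: ev_le => //; apply: ltnW.
  have := @ev_lt _ _ u i.-1; have := @ev_le _ _ u q i.-1; lia.
case: duv => [/standard_degenerate[i' [l [u' [ei li uu]]]]
             |/standard_degenerate[j' [l [v' [ej lj vv]]]]].
  (* With [l = i'] the repeated vertex would be the apex, which [ui'] excludes. *)
  subst i; have {}li : (l < i')%N.
    rewrite ltn_neqAle li andbT; apply/eqP => li'; move: okui.2 => /(_ i' (ltnSn _)).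
    rewrite uu // -[X in (X < _)%N](_ : ev u i'.+1 = _) ?ui //.
    by rewrite uu //; congr (ev u' _); rewrite /unbump; lia.
  rewrite (@eq_mk _ _ _ (fun q => jfun i' (nv0 s) (ev u') (ev v) (unbump l q))).
    rewrite bnorm_degenerate //; try lia.
    apply: (@ok_jfun _ j.+1 _ (nv1 s)) (jdimE s); try lia; last exact: ok_ev.
    split=> q => [r qr ri|qi]; first by apply: ev_le => //; lia.
    have := okui.2 i' (ltnSn _); rewrite uu // (_ : unbump l i' = i'.-1); last by rewrite /unbump; lia.
    by apply: leq_ltn_trans; apply: ev_le; lia.
  by move=> q qk; apply: jfun_unbumpl => // qi; rewrite uu //; lia.
subst j; rewrite (@eq_mk _ _ _ (fun q => jfun i (nv0 s) (ev u) (ev v') (unbump (i + l) q))).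
  rewrite bnorm_degenerate //; try lia.
  by apply: (@ok_jfun _ j'.+1 _ (nv1 s)) (jdimE s); try lia; last exact: ok_ev.
by move=> q qk; apply: jfun_unbumpr => qi; rewrite vv //; lia.
Qed.

(** A simplex of dimension m + 1 with [a] vertices over 0 has m + 2 - a over 1, so m + 1 - a is the
    dimension of F_1 and thus the perverse degree of the cell without apex. *)
Definition perverse_fam (p : perversity) m (ph : fam R X m.+1) :=
  forall a y, (0 < a <= m.+1)%N -> ph a y != 0 -> ((Posz (m.+1 - a))%:E <= p)%E.

Lemma foldc_perverse p s (x : J X s) : perverse_fam p et -> perverse_le p (foldc th et x).
Proof.
move=> pet [i j u v]; rewrite /cell_degree /has_apex /=.
case: (eqVneq (i + j)%N k) => ijk /=; last by rewrite eqxx.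
case: ifP => ui nz.
  case: ifP => [_|_]; first by rewrite leNye.
  have -> : j = (k.+1 - i.+1)%N by lia.
  move: nz; set y := act _ _ => nz; apply: (pet i.+1 y); first by lia.
  by apply: contraNneq nz => ->; rewrite scaler0.
rewrite ifT ?leNye //; apply/existsP; exists ord_max; apply/eqP/val_inj => /=.
move: ui; have := ltn_ord (u ord_max); rewrite (ev_ord u ord_max); lia.
Qed.

End FoldDegenerate.

Lemma dq_act (X : sset) k n q F (z : X n) : ok k.+2 n.+1 F ->
  dq q (act (mk k.+2 n F) z) = act (mk k.+1 n (fun t => F (bump q t))) z.
Proof. by move=> okF; rewrite /dq act_mk //; apply: ok_bump. Qed.

Lemma sum_nat_split (V : nmodType) N m n (F : nat -> V) : (m + n = N)%N ->
  \sum_(0 <= q < N) F q = \sum_(0 <= q < m) F q + \sum_(0 <= q < n) F (m + q)%N.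
Proof. by move=> <-; rewrite !big_mkord big_split_ord. Qed.

Section FoldEval.
Variables (R : pzRingType) (X : sset) (k : nat) (th : fam R X k) (et : fam R X k.+1).

Lemma foldc_et s (x : J X s) (h : (0 < nv1 s)%N) i j
    (u : mono i.+1 (nv0 s).+1) (v : mono j.+1 (nv1 s)) :
  (i + j = k)%N -> (ev u i < nv0 s)%N ->
  foldc th et x (@Bisimplex (standard _) (standard _) i j u v) =
  (-1) ^+ i.+1 *: et i.+1 (act (mk k.+2 (jdim s) (jfun i.+1 (nv0 s) (ev u) (ev v))) (x h)).
Proof. by move=> /eqP ijk ui; rewrite /= ijk ui (bool_irrelevance (mono_gt0 v) h). Qed.

Lemma foldc_th s (x : J X s) (h : (0 < nv1 s)%N) i j
    (u : mono i.+1 (nv0 s).+1) (v : mono j.+1 (nv1 s)) :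
  (i + j = k)%N -> ev u i = nv0 s -> ~~ ((0 < i)%N && (ev u i.-1 == nv0 s)) ->
  foldc th et x (@Bisimplex (standard _) (standard _) i j u v) =
  th i (act (mk k.+1 (jdim s) (jfun i (nv0 s) (ev u) (ev v))) (x h)).
Proof.
move=> /eqP ijk ui /negbTE ui'.
by rewrite /= ijk ui ltnn ui' (bool_irrelevance (mono_gt0 v) h).
Qed.

End FoldEval.

(** * The coboundary in terms of families *)

Section FoldDifferential.
Variables (R : pzRingType) (X : sset) (k : nat) (th : fam R X k) (et : fam R X k.+1).
Hypotheses (nth : bnorm th) (net : bnorm et).
Hypotheses (th_last : forall y, th k.+1 y = 0).
Hypotheses (et0 : forall y, et 0%N y = 0) (et_last : forall y, et k.+2 y = 0).

Let dth : fam R X k.+1 := fun a y => fD th a y + et a y.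
Let det : fam R X k.+2 := fun a y => - fD et a y.

(** In the join the vertices of F_1 are numbered after those of F_0, and this shift accounts for the
    sign of the second term of [bicob]. A face of a cell with apex keeps the apex, except the face
    opposite to it, which contributes [et]. *)
Lemma bicob_foldc s (x : J X s) : bicob (foldc th et x) = foldc dth det x.
Proof.
apply/funext => c.
have [ijk|/eqP] := eqVneq (bidim1 c + bidim2 c)%N k.+1; last first.
  move=> /eqP ijk; rewrite (bicob_homogeneous (foldc_homogeneous th et x)) //.
  by rewrite foldc_homogeneous.
case: c ijk => i j u v /= ijk.
change (gcob (fun i' s' => foldc th et x (@Bisimplex (standard _) (standard _) i' j s' v)) u
  + (-1) ^+ i *: gcob (fun j' t' => foldc th et x (@Bisimplex (standard _) (standard _) i j' u t')) v
  = foldc dth det x (@Bisimplex (standard _) (standard _) i j u v)).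
have h := mono_gt0 v; have ui := ev_lt u (ltnSn i); rewrite ltnS in ui.
have ui' : (i <= k.+1)%N by lia.
have [{}ui|uge] := ltnP (ev u i) (nv0 s).
  have uok q : (q <= i)%N -> (ev u q < nv0 s)%N.
    by move=> qi; apply: leq_ltn_trans ui; apply: ev_le.
  have okF := ok_jet (k := k.+1) v ui ijk.
  rewrite (foldc_et dth det x h) //; set y := act _ (x h).
  have -> : gcob (fun i' s' => foldc th et x (@Bisimplex (standard _) (standard _) i' j s' v)) u =
      \sum_(0 <= q < i.+1) (-1) ^+ q *: ((-1) ^+ i *: et i (dq q y)).
    case: i u ijk {ui' ui} uok okF @y => [|i] u ijk uok okF y.
      by rewrite /= big_nat1 et0 !scaler0.
    rewrite big_mkord; apply: eq_bigr => l _; congr (_ *: _).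
    have li := ltn_ord l.
    rewrite (foldc_et _ _ x h); [|lia|]; last first.
      by rewrite ev_comp // ev_face // uok // /bump; lia.
    congr (_ *: et _ _); rewrite dq_act //; congr (act _ _); apply: eq_mk => q qk.
    by apply: jfun_bumpl => [|qi]; [lia|rewrite ev_comp // ev_face].
  have -> : gcob (fun j' t' => foldc th et x (@Bisimplex (standard _) (standard _) i j' u t')) v =
      \sum_(0 <= m < j.+1) (-1) ^+ m *: ((-1) ^+ i.+1 *: et i.+1 (dq (i.+1 + m)%N y)).
    case: j v ijk okF @y => [|j] v ijk okF y.
      by rewrite /= big_nat1 (_ : i = k.+1) ?et_last ?scaler0 //; lia.
    rewrite big_mkord; apply: eq_bigr => l _; congr (_ *: _).
    have li := ltn_ord l.
    rewrite (foldc_et _ _ x h) //; last by lia.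
    congr (_ *: et _ _); rewrite dq_act //; congr (act _ _); apply: eq_mk => q qk.
    by apply: jfun_bumpr => qi; rewrite ev_comp ?ev_face //; lia.
  rewrite /det /fD [in RHS](@sum_nat_split _ _ i.+1 j.+1) //=; last by lia.
  rewrite opprD scalerDr; congr (_ + _).
    rewrite scalerN -scaleNr exprS mulN1r opprK scaler_sumr; apply: eq_big_nat => q qi.
    rewrite !scalerA -!exprD; congr (_ ^+ _ *: et _ _); [lia|].
    by case/andP: qi => _ ->; rewrite subn1.
  rewrite [RHS]scalerN -scaleNr [in RHS]exprS mulN1r opprK !scaler_sumr; apply: eq_bigr => q _.
  rewrite !scalerA -!exprD; congr (_ ^+ _ *: et _ _); [lia|].
  by rewrite ltnNge leq_addr subn0.
have {uge}ui : ev u i = nv0 s by apply/eqP; rewrite eqn_leq ui.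
(* A repeated apex makes the cell degenerate, and both sides vanish. *)
have [ui2|ui2] := boolP ((0 < i)%N && (ev u i.-1 == nv0 s)).
  rewrite [RHS]/= (introT eqP ijk) ui ltnn ui2 /=.
  have du := two_apex_degenerate ui ui2.
  exact: (bicob_normalized (foldc_binormalized x nth net)
    (b := @Bisimplex (standard _) (standard _) i j u v) (or_introl du)).
have uok q : (q < i)%N -> (ev u q < nv0 s)%N.
  move=> qi; have := @ev_lt _ _ u i.-1; have := @ev_le _ _ u q i.-1; lia.
have okF := ok_jth (k := k.+1) v ui2 ijk.
rewrite (foldc_th dth det x h) //; set y := act _ (x h).
have -> : gcob (fun i' s' => foldc th et x (@Bisimplex (standard _) (standard _) i' j s' v)) u =
    \sum_(0 <= q < i) (-1) ^+ q *: th i.-1 (dq q y) + et i y.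
  case: i u ijk {ui'} ui ui2 uok okF @y => [|i] u ijk ui ui2 uok okF y.
    by rewrite /= big_geq // et0 addr0.
  rewrite /gcob /cob big_ord_recr big_mkord; congr (_ + _).
    apply: eq_bigr => l _; congr (_ *: _).
    have li := ltn_ord l.
    have evi q : (q <= i)%N -> ev (mono_comp u (face (widen_ord (leqnSn i.+1) l))) q = ev u (bump l q).
      by move=> qi; rewrite ev_comp // ev_face.
    rewrite (foldc_th _ _ x h); first 1 last.
    - lia.
    - by rewrite evi // (_ : bump l i = i.+1) // /bump; lia.
    - rewrite evi; last by lia.
      by apply/negP => /andP[i0 /eqP e]; have := uok (bump l i.-1); rewrite e /bump; lia.
    congr (th _ _); rewrite dq_act //; congr (act _ _); apply: eq_mk => q qk.
    by apply: jfun_bumpl => [|qi]; [lia|rewrite evi //; lia].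
  (* The face opposite the apex: its sign cancels the sign that [foldc] puts in front of [et]. *)
  rewrite (foldc_et _ _ x h); first 1 last.
  - lia.
  - by rewrite ev_comp // ev_face // uok // /bump /=; lia.
  rewrite scalerA -exprD addnn -signr_odd odd_double scale1r; congr (et _ (act _ _)).
  apply: eq_mk => q qk; rewrite /jfun; case: ltnP => // qi.
  by rewrite ev_comp // ev_face //; congr (ev u _); rewrite /bump /=; lia.
have -> : gcob (fun j' t' => foldc th et x (@Bisimplex (standard _) (standard _) i j' u t')) v =
    \sum_(0 <= m < j.+1) (-1) ^+ m *: th i (dq (i + m)%N y).
  case: j v ijk okF @y => [|j] v ijk okF y.
    by rewrite /= big_nat1 (_ : i = k.+1) ?th_last ?scaler0 //; lia.
  rewrite big_mkord; apply: eq_bigr => l _; congr (_ *: _).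
  have li := ltn_ord l.
  rewrite (foldc_th _ _ x h) //; last by lia.
  congr (th _ _); rewrite dq_act //; congr (act _ _); apply: eq_mk => q qk.
  by apply: jfun_bumpr => qi; rewrite ev_comp ?ev_face //; lia.
rewrite /dth /fD [in RHS](@sum_nat_split _ _ i j.+1) //=; last by lia.
rewrite addrAC; congr (_ + _ + _).
  by apply: eq_big_nat => q /andP[_ qi]; rewrite qi subn1.
rewrite scaler_sumr; apply: eq_bigr => q _.
by rewrite scalerA -exprD ltnNge leq_addr subn0.
Qed.

End FoldDifferential.

(** * Recovering the families from a blown-up cochain *)

Section Unfold.
Variables (R : pzRingType) (p : perversity) (X : sset).
Let C := blowup_presheaf R p.

Definition simplex2 a b : jsimplex := @JSimplex a b.+1 (ltn_addl a (ltn0Sn b)).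

(** The value on the universal cell with apex. For a + b = k the map [mk _ k id] is the identity on
    vertices; it moves [x] to the dimension [jdim], which equals [k] but not by computation. *)
Definition th_at k (w : Defs.hom C (J X) k) a b (x : X k) : R^o :=
  val (w (simplex2 a b) (fun=> act (mk _ k id) x) : blowup R p (simplex2 a b) k)
    (@Bisimplex (standard a.+1) (standard b.+1) a b (mono_id _) (mono_id _)).

Definition et_at k (w : Defs.hom C (J X) k) a b (x : X k.+1) : R^o :=
  val (w (simplex2 a.+1 b) (fun=> act (mk _ k.+1 id) x) : blowup R p (simplex2 a.+1 b) k)
    (@Bisimplex (standard a.+2) (standard b.+1) a b (mk _ _ id) (mono_id _)).

Definition unfold_th k (w : Defs.hom C (J X) k) : fam R X k := fun a x =>
  if (a <= k)%N then th_at w a (k - a) x else 0.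

Definition unfold_et k (w : Defs.hom C (J X) k) : fam R X k.+1 := fun a x =>
  if a is a'.+1 then if (a' <= k)%N then (-1) ^+ a *: et_at w a' (k - a') x else 0 else 0.

Lemma hom_act k (w : Defs.hom C (J X) k) s t (f : jmap s t) (x : J X t) c :
  val (w s (act1 f x) : blowup R p s k) c =
  val (w t x : blowup R p t k) (cell_map f c).
Proof. by rewrite (smap1_act w f x). Qed.

(** A cell that does not repeat the apex is the image of a universal cell under a map over [1],
    given by [v] over 1 and by [u] without its apex over 0. Naturality of [w] along this map
    determines the value. *)
Lemma foldc_unfold k (w : Defs.hom C (J X) k) s (x : J X s) :
  foldc (unfold_th w) (unfold_et w) x = val (w s x : blowup R p s k).
Proof.
have /asboolP[nw hw _ _] := valP (w s x : blowup R p s k).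
apply/funext => -[i j u v].
have [ijk|ijk] := eqVneq (i + j)%N k; last by rewrite /= ijk hw.
have h := mono_gt0 v; have ui := ev_lt u (ltnSn i); rewrite ltnS in ui.
have [{}ui|uge] := ltnP (ev u i) (nv0 s).
  have uok q : (q <= i)%N -> (ev u q < nv0 s)%N.
    by move=> qi; apply: leq_ltn_trans ui; apply: ev_le.
  rewrite (foldc_et _ _ x h) // /unfold_et (_ : (i <= k)%N = true); last by lia.
  rewrite scalerA -exprD addnn -signr_odd odd_double scale1r.
  rewrite (_ : k - i = j)%N; last by lia.
  have [f0 f0E] : exists f : mono i.+1 (nv0 s), forall q, (q < i.+1)%N -> ev f q = ev u q.
    by apply: ok_mono; split=> q => [r qr ri|qi]; [exact: ev_le|exact: uok].
  pose f : jmap (simplex2 i.+1 j) s := @JMap (simplex2 i.+1 j) s f0 v.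
  have jd : jdim (simplex2 i.+1 j) = k.+1 by rewrite /jdim /=; lia.
  rewrite /et_at (_ : (fun _ => _) = act1 f x).
    rewrite hom_act; congr (val _ _); rewrite /cell_map /bimap /=; congr Bisimplex.
      apply: ev_ext => q qi; rewrite ev_comp // ev_mk //.
        by rewrite ev_cone // f0E.
      by split; lia.
    by rewrite mono_compid.
  apply: funext => h'; rewrite [RHS]/(act (jjoin f) _) (bool_irrelevance (jmap_gt0 f h') h).
  rewrite act_mk; first 1 last.
  - by rewrite jd; split; lia.
  - exact: (ok_jet (k := k)).
  congr (act _ _); apply: eq_mk => q qk; rewrite /jfun /=.
  by case: ltnP => // qi; rewrite f0E.
have {uge}ui : ev u i = nv0 s by apply/eqP; rewrite eqn_leq ui.
have [ui2|ui2] := boolP ((0 < i)%N && (ev u i.-1 == nv0 s)).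
  rewrite /= (introT eqP ijk) ui ltnn ui2 /= nw //; left.
  exact: two_apex_degenerate.
have uok q : (q < i)%N -> (ev u q < nv0 s)%N.
  move=> qi; have := @ev_lt _ _ u i.-1; have := @ev_le _ _ u q i.-1; lia.
rewrite (foldc_th _ _ x h) // /unfold_th (_ : (i <= k)%N = true); last by lia.
rewrite (_ : k - i = j)%N; last by lia.
have [f0 f0E] : exists f : mono i (nv0 s), forall q, (q < i)%N -> ev f q = ev u q.
  by apply: ok_mono; split=> q => [r qr ri|qi]; [apply: ev_le => //; apply: ltnW|exact: uok].
pose f : jmap (simplex2 i j) s := @JMap (simplex2 i j) s f0 v.
have jd : jdim (simplex2 i j) = k by rewrite /jdim /=; lia.
rewrite /th_at (_ : (fun _ => _) = act1 f x).
  rewrite hom_act; congr (val _ _); rewrite /cell_map /bimap /=; congr Bisimplex.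
    apply: ev_ext => q; rewrite mono_compid ltnS leq_eqVlt => /orP[/eqP ->|qi].
      by rewrite ev_cone_max.
    by rewrite ev_cone // f0E.
  by rewrite mono_compid.
apply: funext => h'; rewrite [RHS]/(act (jjoin f) _) (bool_irrelevance (jmap_gt0 f h') h).
rewrite act_mk; first 1 last.
- by rewrite jd; split; lia.
- exact: (ok_jth (k := k)).
congr (act _ _); apply: eq_mk => q qk; rewrite /jfun /=.
by case: ltnP => // qi; rewrite f0E.
Qed.

Section UnfoldFold.
Variables (k : nat) (w : Defs.hom C (J X) k) (th : fam R X k) (et : fam R X k.+1).
Hypothesis wE : forall s x, val (w s x : blowup R p s k) = foldc th et x.

Lemma unfold_th_fold a x : (a <= k)%N -> unfold_th w a x = th a x.
Proof.
move=> ak; rewrite /unfold_th ak /th_at wE.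
rewrite (foldc_th _ _ _ (isT : (0 < nv1 (simplex2 a (k - a)))%N)); first 1 last.
- by lia.
- by rewrite ev_id.
- by case: a {ak} => //= a; rewrite ev_id //; apply/negbT/ltn_eqF.
congr (th _ _); rewrite act_mk; first 1 last.
- apply: (ok_jth (k := k)); last by lia.
  by case: a {ak} => //= a; rewrite ev_id //; apply/negbT/ltn_eqF.
- by rewrite (_ : jdim _ = k); [split|rewrite /jdim /=]; lia.
rewrite -[RHS]act_id -[in RHS]mk_id; congr (act _ _); apply: eq_mk => q qk; rewrite /jfun /=.
by case: ltnP => qi; rewrite ev_id; lia.
Qed.

Lemma unfold_et_fold a x : (0 < a <= k.+1)%N -> unfold_et w a x = et a x.
Proof.
case: a => // a ak; have {}ak : (a <= k)%N by [].
rewrite /unfold_et ak /et_at wE.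
have evi q : (q <= a)%N -> ev (mk a.+1 a.+1 id) q = q.
  by move=> qa; rewrite ev_mk //; split; lia.
rewrite (foldc_et _ _ _ (isT : (0 < nv1 (simplex2 a.+1 (k - a)))%N)); first 1 last.
- by lia.
- by rewrite evi.
rewrite scalerA -exprD addnn -signr_odd odd_double scale1r.
congr (et _ _); rewrite act_mk; first 1 last.
- by apply: (ok_jet (k := k)); [rewrite evi|lia].
- by rewrite (_ : jdim _ = k.+1); [split|rewrite /jdim /=]; lia.
rewrite -[RHS]act_id -[in RHS]mk_id; congr (act _ _); apply: eq_mk => q qk; rewrite /jfun /=.
by case: ltnP => qi; [rewrite evi|rewrite ev_id]; lia.
Qed.

End UnfoldFold.

Lemma hom_degenerate k (w : Defs.hom C (J X) k) s t (f : jmap s t) (x : J X s) (y : J X t) c :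
  x = act1 f y ->
  degenerate (bisimp1 (cell_map f c)) \/ degenerate (bisimp2 (cell_map f c)) ->
  val (w s x : blowup R p s k) c = 0.
Proof.
move=> -> dc; rewrite hom_act.
by have /asboolP[nw _ _ _] := valP (w t y : blowup R p t k); apply: nw.
Qed.

Lemma act_sq_jact s t (f : jmap s t) k l i (y : X k) :
  jdim s = l -> l = k.+1 -> jdim t = k -> (i <= k)%N ->
  (forall q, (q < k.+2)%N ->
    jfun (nv0 s) (nv0 t) (ev (jmap0 f)) (ev (jmap1 f)) q = unbump i q) ->
  (fun=> act (mk _ k.+1 id) (sq i y)) = @act1 (J X) s t f (fun=> act (mk _ k id) y) :> J X s.
Proof.
move=> js lk jt ik fE; apply: funext => h; rewrite /= /jact /sq !act_mk; first 1 last.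
- exact: ok_jjoin.
- by rewrite jt; split; lia.
- by rewrite js lk; split; lia.
- exact: ok_unbump.
by congr (act _ y); apply: eq_mk => q; rewrite js lk => qk; rewrite fE.
Qed.

(** For [i.+1 != a] the vertices i and i + 1 lie on the same side of the cut, so s_i comes from a
    map over [1]; that map makes the universal cell degenerate. *)
Lemma bnorm_unfold_th k (w : Defs.hom C (J X) k) : bnorm (unfold_th w).
Proof.
case: k w => // k w a i y ak ik ia; rewrite /unfold_th ak /th_at.
have [ai|ia'] := ltnP a i.+1.
  have -> : (k.+1 - a = (k - a).+1)%N by lia.
  pose f : jmap (simplex2 a (k - a).+1) (simplex2 a (k - a)) :=
    @JMap (simplex2 a _) (simplex2 a _) (mono_id a) (mk _ _ (unbump (i - a))).
  have okf : ok (k - a).+2 (k - a).+1 (unbump (i - a)) by apply: ok_unbump; lia.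
  apply: (hom_degenerate _ (f := f) (y := fun=> act (mk _ k id) y)).
    apply: act_sq_jact => //; rewrite /jdim /=; try lia.
    move=> q qk; rewrite /jfun; case: ltnP => qa; first by rewrite ev_id // /unbump; lia.
    by rewrite ev_mk //; [rewrite /unbump|]; lia.
  right; exists (k - a)%N, (mk _ _ (unbump (i - a))), (mono_id _); split=> //=.
  by rewrite mono_compid mono_idcomp.
have {ia'}ia : (i.+1 < a)%N by lia.
case: a ak ia => // a ak ia; rewrite subSS.
have [f0 f0E] := ok_mono (ok_unbump (ia : (i < a)%N)).
pose f : jmap (simplex2 a.+1 (k - a)) (simplex2 a (k - a)) :=
  @JMap (simplex2 a.+1 _) (simplex2 a _) f0 (mono_id _).
apply: (hom_degenerate _ (f := f) (y := fun=> act (mk _ k id) y)).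
  apply: act_sq_jact => //; rewrite /jdim /=; try lia.
  move=> q qk; rewrite /jfun; case: ltnP => qa; first by rewrite f0E.
  by rewrite ev_id; [rewrite /unbump|]; lia.
left; exists a, (cone f0), (mono_id _); split=> //=.
by rewrite mono_compid mono_idcomp.
Qed.

Lemma bnorm_unfold_et k (w : Defs.hom C (J X) k) : bnorm (unfold_et w).
Proof.
move=> [|a] i y ak ik ia //; rewrite ltnS in ak; rewrite /unfold_et ak /et_at.
have [ai|ia'] := ltnP a i.
  case: k w y ak ik => [|k] w y ak ik; first by lia.
  have -> : (k.+1 - a = (k - a).+1)%N by lia.
  pose f : jmap (simplex2 a.+1 (k - a).+1) (simplex2 a.+1 (k - a)) :=
    @JMap (simplex2 a.+1 _) (simplex2 a.+1 _) (mono_id a.+1) (mk _ _ (unbump (i - a.+1))).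
  have okf : ok (k - a).+2 (k - a).+1 (unbump (i - a.+1)) by apply: ok_unbump; lia.
  rewrite (hom_degenerate _ (f := f) (y := fun=> act (mk _ k.+1 id) y)) ?scaler0 //.
    apply: act_sq_jact => //; rewrite /jdim /=; try lia.
    move=> q qk; rewrite /jfun; case: ltnP => qa; first by rewrite ev_id // /unbump; lia.
    by rewrite ev_mk //; [rewrite /unbump|]; lia.
  right; exists (k - a)%N, (mk _ _ (unbump (i - a.+1))), (mono_id _); split=> //=.
  by rewrite mono_compid mono_idcomp.
have {ia'}ia : (i < a)%N by lia.
case: a ak ia => // a ak ia.
have -> : (k - a.+1 = k.-1 - a)%N by lia.
have okf := ok_unbump (ia : (i < a.+1)%N).
pose f : jmap (simplex2 a.+2 (k.-1 - a)) (simplex2 a.+1 (k.-1 - a)) :=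
  @JMap (simplex2 a.+2 _) (simplex2 a.+1 _) (mk _ _ (unbump i)) (mono_id _).
rewrite (hom_degenerate _ (f := f) (y := fun=> act (mk _ k id) y)) ?scaler0 //.
  apply: act_sq_jact => //; rewrite /jdim /=; try lia.
  move=> q qk; rewrite /jfun; case: ltnP => qa; first by rewrite ev_mk.
  by rewrite ev_id; [rewrite /unbump|]; lia.
left; exists a, (mk _ _ (unbump i)), (mk _ _ id); split=> //=.
apply: ev_ext => q qa.
have oki m : ok m m.+1 id by split; lia.
rewrite !ev_comp // ev_cone ?ev_mk //; have := okf.2 q qa; rewrite /unbump; try lia.
Qed.

End Unfold.

(** * Restriction to the cut at 0 *)

Section Cut.
Variables (R : pzRingType) (X : sset).

Definition ftrunc k (ps : fam R X k) : fam R X k := fun a y =>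
  if (a <= k)%N then ps a y else 0.

(** The summand of [fD ps] at the cut [k.+1] that is lost when [ps] is truncated: the face omitting
    the only vertex over 1. *)
Definition flast k (ps : fam R X k) : fam R X k.+1 := fun a y =>
  if a == k.+1 then (-1) ^+ k.+1 *: ps k.+1 (dq k.+1 y) else 0.

Lemma fD_ftrunc k (ps : fam R X k) a y :
  fD (ftrunc ps) a y + flast ps a y = ftrunc (fD ps) a y.
Proof.
rewrite /flast /ftrunc; have [->|ak] := eqVneq a k.+1.
  rewrite leqnn /fD !big_mkord big_ord_recr [in RHS]big_ord_recr /= ltnn !subn0 ltnn.
  rewrite scaler0 addr0; congr (_ + _); apply: eq_bigr => q _.
  by rewrite ltn_ord subn1 leqnn.
rewrite addr0; case: (leqP a k.+1) => [ak'|ka]; last by apply: fD_eq0 => b z _ ab; case: leqP => //; lia.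
by apply: eq_fD => b ba _ z; case: leqP => //; lia.
Qed.

Lemma fD_flast k (ps : fam R X k) a y :
  - fD (flast ps) a y = flast (fD ps) a y.
Proof.
rewrite [RHS]/flast; have [->|ak] := eqVneq a k.+2.
  rewrite /fD !big_mkord big_ord_recr /= ltnn subn0.
  rewrite [flast ps k.+2 _]/flast gtn_eqF // scaler0 addr0.
  rewrite exprS mulN1r scaleNr; congr (- _); rewrite scaler_sumr; apply: eq_bigr => q _.
  have q2 := ltn_ord q; rewrite q2 subn1 /flast eqxx !scalerA -!exprD addnC dq_dq //; lia.
(* Exactly two vertices lie over 1, namely k + 1 and k + 2. Omitting one of them and then d_{k+1}
   gives the same simplex in both cases, with opposite signs. *)
have [->|ak'] := eqVneq a k.+1.
  rewrite /fD !big_mkord 2!big_ord_recr big1 /=; last first.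
    by move=> q _; rewrite /flast /= ltn_ord ltn_eqF ?scaler0 //; lia.
  rewrite add0r ltnn ltnNge leqnSn /= subn0 /flast eqxx dq_dq //.
  by rewrite (exprS _ k.+1) mulN1r scaleNr subrr oppr0.
rewrite fD_eq0 ?oppr0 // => b z ba ab; rewrite /flast; case: eqVneq => // bk.
by move: ak ak'; rewrite -bk; lia.
Qed.

Lemma eq_ftrunc k (ps ps' : fam R X k) a y :
  (forall a y, (a <= k)%N -> ps a y = ps' a y) -> ftrunc ps a y = ftrunc ps' a y.
Proof. by move=> e; rewrite /ftrunc; case: ifP => // /e. Qed.

Lemma eq_flast k (ps ps' : fam R X k) a y :
  (forall y, ps k.+1 y = ps' k.+1 y) -> flast ps a y = flast ps' a y.
Proof. by move=> e; rewrite /flast e. Qed.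

Lemma bnorm_ftrunc k (ps : fam R X k) :
  (forall a, (a <= k)%N -> normalized (ps a)) -> bnorm (ftrunc ps).
Proof.
move=> nps; apply: fam_normalized_bnorm => a ak x dx; rewrite /ftrunc.
by case: leqP => // /nps; apply.
Qed.

Lemma bnorm_flast k (ps : fam R X k) : normalized (ps k.+1) -> bnorm (flast ps).
Proof.
move=> nps a i y ak ik ia; rewrite /flast; case: eqVneq => // ak'.
case: k ps nps y ak ik ak' => [|k] ps nps y ak ik ak'; first by lia.
rewrite dq_sq_gt; [|lia|lia]; rewrite nps ?scaler0 //.
by apply/degenerateP; exists i, (dq k.+1 y); split=> //; lia.
Qed.

Lemma perverse_flast p k (ps : fam R X k) : (0 <= p)%E -> perverse_fam p (flast ps).
Proof.
move=> p0 a y _; rewrite /flast; case: (eqVneq a k.+1) => [->|_]; last by rewrite eqxx.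
by rewrite subnn.
Qed.

(* No cell carries the values of [th] at [k.+1] and of [et] at [0] and [k.+2];
   they have to vanish for [fD] to give the coboundary. *)
Definition foldable p k (th : fam R X k) (et : fam R X k.+1) : Prop :=
  [/\ bnorm th /\ bnorm et, (forall y, th k.+1 y = 0), (forall y, et 0%N y = 0),
      (forall y, et k.+2 y = 0) &
      perverse_fam p et /\ perverse_fam p (fun a y => - fD et a y)].

Section Foldh.
Variables (p : perversity) (k : nat) (th : fam R X k) (et : fam R X k.+1).
Hypothesis g : foldable p th et.

Fact foldc_blown_up s (x : J X s) : foldc th et x \in @is_blown_up R p s k.
Proof.
case: g => [[nth net] th1 et0 et2 [pet pdet]]; rewrite unfold_in; apply/asboolP; split.
- exact: foldc_binormalized.
- exact: foldc_homogeneous.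
- exact: foldc_perverse.
- by rewrite bicob_foldc //; apply: foldc_perverse.
Qed.

Fact foldh_subproof s t (f : jmap s t) (x : J X t) :
  (Sub (foldc th et (act1 f x)) (foldc_blown_up (act1 f x)) : blowup R p s k) =
  cact (blowup_presheaf R p) f k (Sub (foldc th et x) (foldc_blown_up x) : blowup R p t k).
Proof. by apply: val_inj; apply/funext => c /=; rewrite foldc_map. Qed.

Definition foldh : Defs.hom (blowup_presheaf R p) (J X) k :=
  @SMap1 (J X) (degree_sset1 (blowup_presheaf R p) k) _ foldh_subproof.

End Foldh.

Section Unfolding.
Variable p : perversity.
Let C := blowup_presheaf R p.

Lemma perverse_unfold_et k (w : Defs.hom C (J X) k) : perverse_fam p (unfold_et w).
Proof.
move=> [|a] y // ak; have {}ak : (a <= k)%N by [].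
rewrite /unfold_et ak /et_at subSS; set wy := val _; set c := Bisimplex _ _ => nz.
have /asboolP[_ _ pw _] := valP (w (simplex2 a.+1 (k - a)) (fun=> act (mk _ k.+1 id) y) : blowup R p _ k).
have /pw : wy c != 0 by apply: contraNneq nz => ->; rewrite scaler0.
rewrite /cell_degree ifF //; apply/negbTE; rewrite /has_apex.
apply/existsPn => i; rewrite -val_eqE.
change ((mk a.+1 a.+1 id i : nat) != a.+1); rewrite -ev_ord ev_mk ?ltn_eqF //.
by split; lia.
Qed.

Lemma diff_unfold k (w : Defs.hom C (J X) k) s x :
  val (hom_diff w s x : blowup R p s k.+1) =
  foldc (fun a y => fD (unfold_th w) a y + unfold_et w a y)
        (fun a y => - fD (unfold_et w) a y) x.
Proof.
rewrite -[LHS]/(bicob (val (w s x : blowup R p s k))) -foldc_unfold bicob_foldc //.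
- exact: bnorm_unfold_th.
- exact: bnorm_unfold_et.
- by move=> y; rewrite /unfold_th ltnn.
- by move=> y; rewrite /unfold_et ltnn.
Qed.

Lemma unfold_th_diff k (w : Defs.hom C (J X) k) a y : (a <= k.+1)%N ->
  unfold_th (hom_diff w) a y = fD (unfold_th w) a y + unfold_et w a y.
Proof. by move=> ak; rewrite (unfold_th_fold (diff_unfold w)). Qed.

Lemma unfold_et_diff k (w : Defs.hom C (J X) k) a y : (0 < a <= k.+2)%N ->
  unfold_et (hom_diff w) a y = - fD (unfold_et w) a y.
Proof. by move=> ak; rewrite (unfold_et_fold (diff_unfold w)). Qed.

Lemma eq_foldc k (th th' : fam R X k) (et et' : fam R X k.+1) s (x : J X s) :
  (forall a y, th a y = th' a y) -> (forall a y, et a y = et' a y) ->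
  foldc th et x = foldc th' et' x.
Proof.
move=> e e'; have -> : th = th' by apply/funext => a; apply/funext => y; exact: e.
by have -> : et = et' by apply/funext => a; apply/funext => y; exact: e'.
Qed.

Lemma foldable_cut k (ps : fam R X k) : (0 <= p)%E ->
  (forall a, (a <= k.+1)%N -> normalized (ps a)) -> foldable p (ftrunc ps) (flast ps).
Proof.
move=> p0 nps; split=> [|y|y|y|].
- split; first by apply: bnorm_ftrunc => a ak; apply: nps; apply: leqW.
  exact/bnorm_flast/nps.
- by rewrite /ftrunc ltnn.
- by rewrite /flast.
- by rewrite /flast gtn_eqF.
- split; first exact: perverse_flast.
  by move=> a y ak; rewrite fD_flast; apply: perverse_flast.
Qed.

Lemma bicob_cut k (ps : fam R X k) s (x : J X s) :
  (forall a, (a <= k.+1)%N -> normalized (ps a)) ->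
  bicob (foldc (ftrunc ps) (flast ps) x) = foldc (ftrunc (fD ps)) (flast (fD ps)) x.
Proof.
move=> nps; rewrite bicob_foldc; first 1 last.
- by apply: bnorm_ftrunc => a ak; apply: nps; apply: leqW.
- exact/bnorm_flast/nps.
- by move=> y; rewrite /ftrunc ltnn.
- by move=> y; rewrite /flast.
- by move=> y; rewrite /flast gtn_eqF.
by apply: eq_foldc => a y; [exact: fD_ftrunc|exact: fD_flast].
Qed.

(** In degree 0 there is nothing to bound, so the cocycle itself must vanish. The prism formula for
    [et] expresses [et] at the cut 1 through [fS et], and the one for [th] turns this into the
    difference of [th] at the cuts 0 and 1, both zero. *)
Lemma hom_eq0_cut (w : Defs.hom C (J X) 0) :
  hom_diff w = 0 -> (forall y, unfold_th w 0%N y = 0) -> w = 0.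
Proof.
move=> dw w0.
have R1 a y : (a <= 1)%N -> fD (unfold_th w) a y + unfold_et w a y = 0.
  by move=> a1; rewrite -unfold_th_diff // dw /unfold_th a1.
have R2 a y : (0 < a <= 2)%N -> fD (unfold_et w) a y = 0.
  move=> a2; apply/eqP; rewrite -oppr_eq0 -unfold_et_diff // dw.
  by case: a a2 => // a /=; rewrite ltnS => a2; rewrite /unfold_et a2 /et_at scaler0.
have eta1 y : unfold_et w 1%N y = 0.
  have := fS_fD (unfold_et w) (a := 1%N) y isT.
  rewrite fS_eq0 => [|[|[|b]] z] //; last by rewrite R2.
  rewrite sub0r add0r.
  rewrite fD_eq0 => [/esym/eqP|[|[|b]] z // _ _]; first by rewrite oppr_eq0 => /eqP.
    by rewrite fS0.
  rewrite -[LHS]opprK -fSN (_ : fS _ 1%N z = fS (fD (unfold_th w)) 1%N z).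
    rewrite fS_fD_low // w0 /unfold_th.
    by rewrite subrr oppr0.
  apply: eq_fS => b b1 t; apply/eqP; rewrite eq_sym -addr_eq0 R1 //; lia.
apply: smap1_ext => s x; apply: val_inj; rewrite -foldc_unfold.
apply/funext => -[i j u v] /=; case: eqVneq => //= ij0.
case: ifP => _; last case: ifP => _ //.
  case: i u ij0 => // u _; exact: etrans (congr1 _ (eta1 _)) (scaler0 _ _).
by case: i u ij0 => // u _; exact: w0.
Qed.

(** The cocycle equations are [fD th = - et] and [fD et = 0]. By the prism formula the pair of
    [c - fS th] and [fS et] is then a primitive of the pair of [th] and [et]; what remains is to
    truncate it at the last cuts. *)
Lemma hom_coboundary_cut k (w : Defs.hom C (J X) k.+1) (c : X k -> R^o) : (0 <= p)%E ->
  hom_diff w = 0 -> normalized c -> unfold_th w 0%N =1 cob c ->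
  exists v, w = hom_diff v.
Proof.
move=> p0 dw nc wc; pose th := unfold_th w; pose et := unfold_et w.
have R1 a y : (a <= k.+2)%N -> fD th a y = - et a y.
  move=> ak; apply/eqP; rewrite -addr_eq0 -unfold_th_diff // dw.
  by rewrite /unfold_th ak.
have R2 a y : (0 < a <= k.+3)%N -> fD et a y = 0.
  move=> ak; apply/eqP; rewrite -oppr_eq0 -unfold_et_diff // dw.
  by case: a ak => // a ak; rewrite /unfold_et ifT // /et_at scaler0.
have et0 y : et 0%N y = 0 by [].
have et_hi a y : (k.+2 < a)%N -> et a y = 0.
  by case: a => // a ka; rewrite /et /unfold_et ifF //; lia.
have th_hi a y : (k.+1 < a)%N -> th a y = 0 by move=> ka; rewrite /th /unfold_th ifF //; lia.
pose ps : fam R X k := fun a y => c y - fS th a y.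
have nS a : (a <= k.+1)%N -> normalized (fS th a).
  by move=> ak; apply: fS_normalized => //; apply: bnorm_unfold_th.
have nSe a : (a <= k.+2)%N -> normalized (fS et a).
  by move=> ak; apply: fS_normalized => //; apply: bnorm_unfold_et.
have nps a : (a <= k.+1)%N -> normalized (ps a).
  by move=> ak y dy; rewrite /ps nc // nS // subrr.
have L1 a y : (a <= k.+2)%N -> fD ps a y = th a y - fS et a y.
  move=> ak; rewrite fDB fD_const -wc; have := fS_fD th y ak.
  rewrite (@eq_fS _ _ _ _ (fun a y => - et a y)) => [|b b1 z]; last by rewrite R1 //; lia.
  rewrite fSN => /(canRL (addKr _)); rewrite opprK => ->.
  by rewrite -/th opprD opprB addrCA [th 0%N y + _]addrCA subrr addr0 addrC.
have L2 a y : (a <= k.+3)%N -> fD (fS et) a y = - et a y.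
  move=> ak; have := fS_fD et y ak; rewrite et0 sub0r => <-.
  by rewrite fS_eq0 ?add0r // => b z b1; rewrite R2 //; lia.
pose A : fam R X k.+1 := ftrunc (fS et).
(* [flast ps] compensates for the truncation of [ps]. *)
pose et' : fam R X k.+1 := fun a y => flast ps a y + A a y.
have E1 a y : fD (ftrunc ps) a y + et' a y = th a y.
  rewrite addrA fD_ftrunc /A /ftrunc; case: leqP => ak; last by rewrite addr0 th_hi.
  by rewrite L1 ?subrK //; lia.
have E2 a y : - fD et' a y = et a y.
  rewrite fDD opprD fD_flast.
  have [ak|ak] := leqP a k.+1.
    rewrite /flast ltn_eqF // add0r.
    rewrite (@eq_fD _ _ _ _ (fS et)) => [|b b1 _ z]; last by rewrite /A /ftrunc (leq_trans b1).
    by rewrite L2 ?opprK //; lia.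
  have [ak'|ak'] := ltnP k.+2 a.
    rewrite et_hi // /flast gtn_eqF // add0r fD_eq0 ?oppr0 // => b z _ ab.
    by rewrite /A /ftrunc leqNgt (_ : (_ < _)%N = true) //; lia.
  (* The last face needs [fS et] at the cut k + 2, which truncation has removed from [A]. By [L1],
     and since [th] vanishes at this cut, [flast ps] supplies exactly this term. *)
  have {ak ak'}-> : a = k.+2 by lia.
  rewrite /flast eqxx L1 // th_hi // sub0r.
  rewrite -[RHS]opprK -(L2 k.+2 y) //.
  rewrite /fD !big_mkord big_ord_recr [in RHS]big_ord_recr /= opprD [in RHS]opprD addrC.
  rewrite !ltnn !subn0 [A k.+2 _]/A /ftrunc ltnn scaler0 oppr0 addr0 scalerN.
  by congr (- _ - _); apply: eq_bigr => q _; rewrite ltn_ord subn1 /A /ftrunc leqnn.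
have f' : foldable p (ftrunc ps) et'.
  have [[n1 n2] h1 h2 h3 [pe _]] := foldable_cut p0 nps.
  split=> // [|y|y|].
  - split=> // a i y ak ik ia; rewrite /et' n2 // add0r.
    exact: (@bnorm_ftrunc k.+1 _ (fun b bk => nSe b (leqW bk)) a i y ak ik ia).
  - by rewrite /et' h2 add0r /A /ftrunc fS0.
  - by rewrite /et' h3 add0r /A /ftrunc ltnn.
  split=> a y ak; last by rewrite E2 => nz; apply: perverse_unfold_et nz.
  have [-> _|ak'] := eqVneq a k.+1; first by rewrite subnn.
  (* At the cut a, [fS et] involves [et] at cuts b <= a one dimension higher, and k + 1 - a <= k + 2
     - b: the prism operator preserves the perversity bound. *)
  rewrite /et' /flast (negPf ak') add0r /A /ftrunc (_ : (a <= _)%N = true); last by lia.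
  apply: contraNT => np; apply/eqP/fS_eq0 => b z b1; apply/eqP.
  apply: contraNT np => /(@perverse_unfold_et _ w b z) le_p.
  apply: le_trans (le_p _); last by lia.
  by rewrite lee_fin; lia.
exists (foldh f'); apply: smap1_ext => s x; apply: val_inj; rewrite -foldc_unfold.
have [[n1 n2] h1 h2 h3 _] := f'.
rewrite -[RHS]/(bicob (foldc (ftrunc ps) et' x)) bicob_foldc //.
by apply: eq_foldc => a y; [rewrite E1|rewrite E2].
Qed.
End Unfolding.
End Cut.

(** * Restriction to the cut 0 in cohomology *)

Lemma injective_surjective_bijective (A B : Type) (f : A -> B) :
  injective f -> (forall y, exists x, f x = y) -> bijective f.
Proof.
move=> fi /boolp.choice[g gK]; exists g => // x; exact/fi/gK.
Qed.

Section CohomologyMapFacts.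
Variables (R : pzRingType) (C D : complex R) (f : cmap C D) (n : nat).

Lemma cohomology_map_injective :
  (forall z : cocycle C n, coboundary (f n (val z)) -> coboundary (val z)) ->
  injective (@cohomology_map R C D f n).
Proof.
move=> h x y; have [z ->] := coclassP x; have [t ->] := coclassP y.
rewrite !cohomology_mapE => /coclass_eq /=; rewrite -linearB => b.
by apply/coclass_eq; rewrite -linearB; apply: h.
Qed.

Lemma cohomology_map_bijective :
  (forall z : cocycle C n, coboundary (f n (val z)) -> coboundary (val z)) ->
  (forall t : cocycle D n, exists z : cocycle C n, f n (val z) = val t) ->
  bijective (@cohomology_map R C D f n).
Proof.
move=> fi fs; apply: injective_surjective_bijective; first exact: cohomology_map_injective.
move=> y; have [t ->] := coclassP y; have [z zE] := fs t.
by exists (coclass z); rewrite cohomology_mapE; congr coclass; apply: val_inj.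
Qed.

End CohomologyMapFacts.

Section CutMap.
Variables (R : pzRingType) (p : perversity) (X : sset).
Let C := blowup_presheaf R p.

Fact ncut_subproof k (w : Defs.hom C (J X) k) : unfold_th w 0%N \in @is_normalized R X k.
Proof.
rewrite unfold_in; apply/asboolP => x /degenerateP.
case: k w x => // k w x [i [y [ik ->]]].
exact: (@bnorm_unfold_th R p X k.+1 w 0%N i y (leq0n _) ik).
Qed.

Definition ncut_fun k (w : Defs.hom C (J X) k) : ncochain R X k :=
  Sub (unfold_th w 0%N) (ncut_subproof w).

Fact ncut_linear k : linear (@ncut_fun k).
Proof. by move=> a v w; apply: val_inj. Qed.
HB.instance Definition _ k := GRing.isLinear.Build R _ _ _ (@ncut_fun k) (@ncut_linear k).

Fact ncut_diff k (w : Defs.hom C (J X) k) : ncut_fun (hom_diff w) = ncob (ncut_fun w).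
Proof.
apply: val_inj; apply/funext => y; rewrite /= unfold_th_diff // addr0 cob_fD.
by apply: eq_fD => -[].
Qed.

Definition ncut : cmap (blowup_cochains R p (J X)) (ncomplex R X) :=
  @CMap R (blowup_cochains R p (J X)) (ncomplex R X) (fun k => @ncut_fun k) ncut_diff.

Hypothesis p0 : (0 <= p)%E.

Fact cut_foldable k (c : ncochain R X k) :
  foldable p (ftrunc (fun=> val c)) (flast (fun=> val c)).
Proof. by apply: foldable_cut => // a _; apply/asboolP/(valP c). Qed.

(** The constant family ignores the cut. It gives a section of [ncut] compatible with coboundaries,
    whence surjectivity; in perversity 0 it also compares cochains of a join with blown-up
    cochains. *)
Definition hom_cut k (c : ncochain R X k) : Defs.hom C (J X) k := foldh (cut_foldable c).

Lemma hom_diff_cut k (c : ncochain R X k) : hom_diff (hom_cut c) = hom_cut (ncob c).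
Proof.
apply: smap1_ext => s x; apply: val_inj.
rewrite -[LHS]/(bicob (foldc (ftrunc (fun=> val c)) (flast (fun=> val c)) x)) bicob_cut.
  by apply: eq_foldc => a y; [apply: eq_ftrunc|apply: eq_flast] => *; apply: fD_const.
by move=> a _; apply/asboolP/(valP c).
Qed.

Lemma ncut_hom_cut k (c : ncochain R X k) : ncut k (hom_cut c) = c.
Proof.
apply: val_inj; apply/funext => y /=.
by rewrite (@unfold_th_fold _ _ _ _ _ (ftrunc (fun=> val c)) (flast (fun=> val c))).
Qed.

Lemma cohomology_ncut_bijective k : bijective (@cohomology_map R _ _ ncut k).
Proof.
apply: cohomology_map_bijective => [[w]|[c]] /=; rewrite unfold_in => /eqP dw.
  case: k w dw => [|k] w dw /=.
    by move=> e; apply: hom_eq0_cut => // y; exact: (congr1 (fun c => val c y) e).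
  move=> [c e]; apply: (hom_coboundary_cut (c := val c)) => //.
    exact/asboolP/(valP c).
  by move=> y; exact: (congr1 (fun c => val c y) e).
have dc : hom_cut c \in @is_cocycle R (blowup_cochains R p (J X)) k.
  rewrite unfold_in; apply/eqP; rewrite -[LHS]/(hom_diff _) hom_diff_cut.
  rewrite -[ncob c]/(diff (ncomplex R X) k c) dw.
  apply: smap1_ext => s x; apply: val_inj => /=.
  rewrite (@eq_foldc _ _ _ _ (fun=> fun=> 0) _ (fun=> fun=> 0)) => [|a y|a y].
  - by apply/funext => -[i j u v] /=; rewrite scaler0; do !case: ifP.
  - by rewrite /ftrunc; case: ifP.
  - by rewrite /flast scaler0; case: ifP.
by exists (Sub (hom_cut c) dc); apply: ncut_hom_cut.
Qed.

End CutMap.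

Lemma ncut_Jmap R p X Y (g : smap X Y) k (w : Defs.hom (blowup_presheaf R p) (J Y) k) :
  ncut R p X k (hom_pull (Jmap g) w) = nmap g (ncut R p Y k w).
Proof.
apply: val_inj; apply/funext => y /=; rewrite /unfold_th /= /th_at /=.
congr (val (w _ _) _); apply/funext => h; exact: smap_act.
Qed.

(** * Blown-up cochains of perversity zero on a simplex *)

Section SimplexCochains.
Variables (R : pzRingType) (s : jsimplex).

Fact zero_perversity_ge0 : (0 <= zero_perversity)%E.
Proof. exact: lexx. Qed.

Definition scut k (c : ncochain R (standard (jdim s).+1) k) : blowup R zero_perversity s k :=
  hom_cut zero_perversity_ge0 c s (fun=> mono_id _).

(* The cell [b] is the join cell of the simplex [z]; when [z] lies over 0, it is
   [z] times an arbitrary vertex over 1. *)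
Definition cell_of k (z : mono k.+1 (jdim s).+1) (b : cell s) : Prop :=
  let: Bisimplex i j u v := b in (i + j = k)%N /\
  ([/\ (ev u i < nv0 s)%N, j = 0%N & forall q, (q < k.+1)%N -> ev z q = ev u q] \/
   [/\ ev u i = nv0 s, (forall q, (q < i)%N -> (ev u q < nv0 s)%N) &
       forall q, (q < k.+1)%N -> ev z q = jfun i (nv0 s) (ev u) (ev v) q]).

Lemma scut_cell_of k (c : ncochain R (standard (jdim s).+1) k) z b :
  cell_of z b -> val (scut c) b = val c z.
Proof.
case: b => i j u v [ijk]; have h := mono_gt0 v; case=> [[ui j0 zu]|[ui uok zu]].
  have ik : i = k by lia.
  subst i; rewrite [LHS](foldc_et _ _ _ h) // /flast eqxx.
  rewrite scalerA -exprD addnn -signr_odd odd_double scale1r dq_act; last exact: (ok_jet (k := k)).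
  congr (val c _); rewrite [LHS]mono_idcomp; apply: ev_mk_eq => q qk.
  have -> : bump k.+1 q = q by rewrite /bump; lia.
  by rewrite /jfun qk zu.
rewrite [LHS](foldc_th _ _ _ h) //; last by case: i u uok {ui ijk zu} => //= i u /(_ i); lia.
rewrite /ftrunc (_ : (i <= k)%N = true); last by lia.
by congr (val c _); rewrite [LHS]mono_idcomp; apply: ev_mk_eq => q qk; rewrite zu.
Qed.

Lemma cell_of_exists k (z : mono k.+1 (jdim s).+1) :
  (0 < nv1 s)%N -> exists b, cell_of z b.
Proof.
move=> h; have js := jdimE s.
(* The least such [i] is the number of vertices of [z] over 0; the first disjunct makes it k + 1
   when [z] lies entirely over 0. *)
pose P i := (k < i)%N || (nv0 s <= ev z i)%N.
have exP : exists i, P i by exists k.+1; rewrite /P ltnSn.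
case: (ex_minnP exP) => i Pi imin.
have zlt q : (q < i)%N -> (ev z q < nv0 s)%N.
  by move=> qi; rewrite ltnNge; apply/negP => zq; have := imin q; rewrite /P zq orbT => /(_ isT); lia.
have ik : (i <= k.+1)%N by apply: imin; rewrite /P ltnSn.
have [ik1|ik1] := ltnP k i.
  have {ik ik1}ik : i = k.+1 by lia.
  have oku : ok k.+1 (nv0 s).+1 (ev z).
    by split=> [q r|q qk]; [exact: ev_le|apply: ltnW; rewrite ltnS zlt // ik].
  have okv : ok 1 (nv1 s) (fun=> 0%N) by split.
  have [u uE] := ok_mono oku; have [v _] := ok_mono okv.
  exists (@Bisimplex (standard _) (standard _) k 0 u v); split; first by rewrite addn0.
  by left; split=> // [|q qk]; rewrite uE // zlt // ik.
have zge q : (i <= q)%N -> (q <= k)%N -> (nv0 s <= ev z q)%N.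
  move=> iq qk; apply: leq_trans (ev_le z iq _) => //.
  by case/orP: Pi => //; lia.
have [u uE] : exists u : mono i.+1 (nv0 s).+1,
    forall q, (q < i.+1)%N -> ev u q = if (q < i)%N then ev z q else nv0 s.
  apply: ok_mono; split=> [q r qr ri|q qi]; last by case: ifP => // /zlt; lia.
  case: (ltnP r i) => ri'; first by rewrite (leq_ltn_trans qr) // ev_le //; lia.
  by case: ifP => // /zlt; lia.
have [v vE] : exists v : mono (k - i).+1 (nv1 s),
    forall q, (q < (k - i).+1)%N -> ev v q = (ev z (i + q) - nv0 s)%N.
  apply: ok_mono; split=> [q r qr ri|q qi]; first by apply: leq_sub2r; apply: ev_le; lia.
  have := @ev_lt _ _ z (i + q)%N; have := @zge (i + q)%N; lia.
exists (@Bisimplex (standard _) (standard _) i (k - i) u v); split; first by lia.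
right; split=> [|q qi|q qk].
- by rewrite uE // ltnn.
- by rewrite uE ?qi ?zlt //; apply: leqW.
rewrite /jfun; case: ltnP => qi; first by rewrite uE ?qi //; lia.
by rewrite vE; [rewrite subnKC ?subnKC ?zge|]; lia.
Qed.

(** With an apex, [i] counts the vertices of [z] over 0, and [u] and [v] are read off from [z].
    Without an apex the vertex over 1 would be undetermined. *)
Lemma cell_of_inj k (z : mono k.+1 (jdim s).+1) i j
    (u : mono i.+1 (nv0 s).+1) (v : mono j.+1 (nv1 s)) b :
  ev u i = nv0 s -> cell_of z (@Bisimplex (standard _) (standard _) i j u v) -> cell_of z b ->
  b = @Bisimplex (standard _) (standard _) i j u v.
Proof.
case: b => i' j' u' v' ui [ijk [[]|[_ uok zu]]]; first by rewrite ui ltnn.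
case=> ijk' [[ui' j0 zu']|[ui' uok' zu']].
  have ik : (i < k.+1)%N by lia.
  have := zu _ ik; rewrite zu' // /jfun ltnn.
  by have := @ev_le _ _ u' i i'; lia.
have ii' : i' = i.
  have [ii'|ii'|//] := ltngtP i' i.
    have ik : (i' < k.+1)%N by lia.
    by have := zu _ ik; rewrite zu' // /jfun ltnn ii'; have := uok _ ii'; lia.
  have ik : (i < k.+1)%N by lia.
  by have := zu _ ik; rewrite zu' // /jfun ltnn ii'; have := uok' _ ii'; lia.
subst i'; have jj' : j' = j by lia.
subst j'; congr Bisimplex.
  apply: ev_ext => q; rewrite ltnS leq_eqVlt => /orP[/eqP ->|qi]; first by rewrite ui.
  by have := zu q; rewrite zu' /jfun ?qi; [apply|]; lia.
apply: ev_ext => q qj; have iq : (i + q < k.+1)%N by lia.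
have := zu _ iq; rewrite zu' // /jfun (_ : (i + q < i)%N = false) ?addKn; lia.
Qed.

Lemma scut_inj k (c c' : ncochain R (standard (jdim s).+1) k) :
  (0 < nv1 s)%N -> scut c = scut c' -> c = c'.
Proof.
move=> h e; apply: val_inj; apply/funext => z; have [b bz] := cell_of_exists z h.
by rewrite -!(scut_cell_of _ bz) e.
Qed.

Lemma no_apex i j (u : mono i.+1 (nv0 s).+1) (v : mono j.+1 (nv1 s)) :
  (ev u i < nv0 s)%N -> has_apex (@Bisimplex (standard _) (standard _) i j u v) = false.
Proof.
move=> ui; apply/negbTE/existsPn => q; rewrite -val_eqE.
change ((u q : nat) != nv0 s); rewrite -ev_ord.
apply/negbT/ltn_eqF; apply: leq_ltn_trans ui; apply: ev_le; last exact: ltnSn.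
by rewrite -ltnS.
Qed.

Section PerversityZero.
Variables (k : nat) (w : blowup R zero_perversity s k).

Lemma blowup0_no_apex i j (u : mono i.+1 (nv0 s).+1) (v : mono j.+1 (nv1 s)) :
  (ev u i < nv0 s)%N -> (0 < j)%N -> val w (@Bisimplex (standard _) (standard _) i j u v) = 0.
Proof.
have /asboolP[_ _ pw _] := valP w.
move=> ui j0; apply/eqP; apply: contraTT j0 => /pw.
by rewrite /cell_degree no_apex // /zero_perversity lee_fin /=; lia.
Qed.

(* The cocycle condition imposed on the coboundary in perverse degree 1 makes
   the value independent of the vertex over 1. *)
Lemma blowup0_vertex i (u : mono i.+1 (nv0 s).+1) (v v' : mono 1 (nv1 s)) :
  (ev u i < nv0 s)%N ->
  val w (@Bisimplex (standard _) (standard _) i 0 u v) =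
  val w (@Bisimplex (standard _) (standard _) i 0 u v').
Proof.
move=> ui; wlog vv : v v' / (ev v 0 <= ev v' 0)%N.
  move=> hw; have [|/ltnW vv] := leqP (ev v 0) (ev v' 0); first exact: hw.
  by apply: esym; apply: hw.
have [t tE] : exists t : mono 2 (nv1 s), forall q, (q < 2)%N ->
    ev t q = if q == 0%N then ev v 0 else ev v' 0.
  apply: ok_mono; split=> [[|q] [|r]|[|q]] //= _; exact: ev_lt.
have /asboolP[_ _ _ pdw] := valP w.
have b0 : bicob (val w) (@Bisimplex (standard _) (standard _) i 1 u t) = 0.
  apply/eqP; apply: contraTT isT => /pdw.
  by rewrite /cell_degree no_apex.
have f0 : mono_comp t (face ord0) = v'.
  apply: ev_ext => -[|q] // _; rewrite ev_comp // ev_face // tE //.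
have f1 : mono_comp t (face (lift ord0 ord0)) = v.
  apply: ev_ext => -[|q] // _; rewrite ev_comp // ev_face // tE //.
move: b0; change (gcob (fun i' s' => val w (@Bisimplex (standard _) (standard _) i' 1 s' t)) u
  + (-1) ^+ i *: gcob (fun j' t' => val w (@Bisimplex (standard _) (standard _) i j' u t')) t
  = 0 -> val w (@Bisimplex (standard _) (standard _) i 0 u v) =
         val w (@Bisimplex (standard _) (standard _) i 0 u v')).
have -> : gcob (fun i' s' => val w (@Bisimplex (standard _) (standard _) i' 1 s' t)) u = 0.
  case: i u ui => // i u ui; rewrite /gcob /cob big1 // => l _.
  rewrite blowup0_no_apex ?scaler0 //.
  by rewrite ev_comp // ev_face //; apply: leq_ltn_trans ui; apply: ev_le; rewrite // /bump; have := ltn_ord l; lia.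
rewrite add0r /= /cob !big_ord_recl big_ord0 addr0 /= f0 f1 expr0 scale1r expr1 scaleN1r.
move/eqP; rewrite -signr_odd scaler_sign; case: ifP => _; rewrite ?oppr_eq0 subr_eq0 => /eqP -> //.
Qed.

End PerversityZero.

(** The cochain at [z] is the value of [w] on a chosen cell of [z]. The choice is harmless: a cell
    with apex is determined by [z], and without apex [blowup0_vertex] applies. Cells without apex
    whose second factor has positive dimension carry the value 0 on both sides. *)
Lemma scut_surj k (w : blowup R zero_perversity s k) : (0 < nv1 s)%N -> exists c, scut c = w.
Proof.
move=> h; have /asboolP[nw hw _ _] := valP w.
have [b bP] := boolp.choice (fun z => @cell_of_exists k z h).
have nc : normalized (X := standard (jdim s).+1) (fun z => val w (b z) : R^o).
  move=> z /standard_degenerate[k' [l [z' [ek lk zz]]]].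
  have zl : ev z l = ev z l.+1.
    by rewrite !zz //; [congr (ev z' _); rewrite /unbump; lia|lia|lia].
  apply: nw; have := bP z; case: (b z) => i j u v [ijk []].
    move=> [ui j0 zu]; left; apply: (@ev_degenerate _ _ u l); first by lia.
    by rewrite -!zu //; lia.
  move=> [ui uok zu]; have {zl} : jfun i (nv0 s) (ev u) (ev v) l = jfun i (nv0 s) (ev u) (ev v) l.+1.
    by rewrite -!zu //; lia.
  rewrite /jfun; case: (ltnP l.+1 i) => li.
    by rewrite ltnW // => ul; left; apply: (@ev_degenerate _ _ u l) => //; lia.
  (* A repetition cannot straddle the cut, as the two values would lie over different vertices of
     [1]. *)
  case: ltnP => li' vl; first by have := uok _ li'; lia.
  right; apply: (@ev_degenerate _ _ v (l - i)); first by lia.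
  by apply: (@addnI (nv0 s)); rewrite vl -subSn.
have ncP : (fun z => val w (b z) : R^o) \in @is_normalized R (standard (jdim s).+1) k.
  by rewrite unfold_in; apply/asboolP.
exists (Sub (fun z => val w (b z)) ncP); apply: val_inj; apply/funext => -[i j u v].
set c := Sub _ _; have /asboolP[nc' hc _ _] := valP (scut c).
have [ijk|ijk] := eqVneq (i + j)%N k; last by rewrite hw // hc.
have ui := ev_lt u (ltnSn i); rewrite ltnS in ui.
have [{}ui|uge] := ltnP (ev u i) (nv0 s).
  have [j0|j0] := posnP j; last by rewrite !blowup0_no_apex.
  have ik : i = k by lia.
  subst i j; have js := jdimE s.
  have okz : ok k.+1 (jdim s).+1 (ev u).
    split=> [q r|q qk]; first exact: ev_le.
    by have := @ev_le _ _ u q k; lia.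
  have [z zE] := ok_mono okz.
  have zuv : cell_of z (@Bisimplex (standard _) (standard _) k 0 u v) by split=> //; left.
  rewrite (scut_cell_of c zuv) /=; have := bP z; case: (b z) => i j u' v' [ijk' []].
    move=> [ui' j0 zu']; have ik : i = k by lia.
    subst i j; have -> : u' = u by apply: ev_ext => q qk; rewrite -zu' // zE.
    exact: blowup0_vertex.
  move=> [ui' uok' zu']; have ik : (i <= k)%N by lia.
  by have := zu' i ik; rewrite zE // /jfun ltnn; have := @ev_le _ _ u i k; lia.
have {uge}ui : ev u i = nv0 s by apply/eqP; rewrite eqn_leq ui.
have [ui2|ui2] := boolP ((0 < i)%N && (ev u i.-1 == nv0 s)).
  by have du := two_apex_degenerate ui ui2; rewrite nw ?nc' //; left.
have uok q : (q < i)%N -> (ev u q < nv0 s)%N.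
  move=> qi; have := @ev_lt _ _ u i.-1; have := @ev_le _ _ u q i.-1; lia.
have [z zE] := ok_mono (ok_jth (k := k) v ui2 ijk).
have zuv : cell_of z (@Bisimplex (standard _) (standard _) i j u v) by split=> //; right.
by rewrite (scut_cell_of c zuv) /= (cell_of_inj ui zuv (bP z)).
Qed.

End SimplexCochains.

(** * Homotopies indexed by a cut *)

Section CutHomotopy.
Variables (R : pzRingType) (X Y : sset) (F : nat -> forall k, X k -> Y k).
Hypothesis F_face : forall a k q (x : X k.+1), (q <= k.+1)%N ->
  dq q (F a x) = F (a - (q < a)) (dq q x).
Hypothesis F_degeneracy : forall a k i (x : X k), (i <= k)%N -> i.+1 != a ->
  F a (sq i x) = sq i (F (a - (i < a)) x).
Variables f0 f1 : smap X Y.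
Hypothesis F_first : forall k (x : X k), F 0 x = f0 k x.
Hypothesis F_last : forall k (x : X k), F k.+1 x = f1 k x.

(** A simplex with a cut is a simplex of X x Delta[1], and [F] is a homotopy from [f0] to [f1]: a
    degeneracy s_i of the product never has its cut between i and i + 1. Evaluating [c] on [F] gives
    a family killed by [fD], so the prism formula leaves only the two ends. *)
Lemma cut_homotopy k (c : ncochain R Y k) :
  ncob c = 0 -> coboundary (C := ncomplex R X) (nmap f0 c - nmap f1 c).
Proof.
move=> dc; have dc0 y : cob (val c) y = 0 by exact: (congr1 (fun d => val d y) dc).
pose th : fam R X k := fun a x => val c (F a x).
have Dth a x : fD th a x = 0.
  rewrite -[RHS](dc0 (F a x)) -(fD_const (k := k) _ 0) /fD; apply: eq_big_nat => q qk.
  by congr (_ *: val c _); rewrite F_face //; lia.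
have SDth a x : fS (fD th) a x = 0 by apply: fS_eq0 => *; apply: Dth.
have nth : bnorm th.
  have /asboolP nc := valP c; case: k c nc @th {dc dc0 Dth SDth} => // k c nc th a i y _ ik ia.
  rewrite /th F_degeneracy // nc //; apply/degenerateP.
  by exists i, (F (a - (i < a)) y).
case: k c dc dc0 @th Dth SDth nth => [|k] c dc dc0 th Dth SDth nth /=.
  apply: val_inj; apply/funext => x; rewrite -[LHS]/(val c (f0 _ x) - val c (f1 _ x)).
  have := fS_fD_low th (a := 1%N) x isT; rewrite SDth /th F_first F_last => <- //.
have ncS : fS th k.+1 \in @is_normalized R X k.
  by rewrite unfold_in; apply/asboolP; apply: fS_normalized.
exists (Sub (fS th k.+1) ncS); apply: val_inj; apply/funext => x.
rewrite -[LHS]/(val c (f0 _ x) - val c (f1 _ x)) -F_first -F_last.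
(* At the last cut every face lowers the cut, so [fD (fS th)] there is the ordinary coboundary of
   [fS th k.+1]. *)
have := fS_fD th x (leqnn k.+2); rewrite SDth add0r => <-.
rewrite /= /cob /fD big_mkord; apply: eq_bigr => q _.
by rewrite ltn_ord subn1 face_mk.
Qed.

End CutHomotopy.

(** * Representing cochains *)

Section Representing.
Variable R : pzRingType.

Definition yoneda (X : sset) N (x : X N) : smap (standard N.+1) X :=
  @SMap (standard N.+1) X (fun _ f => act f x) (fun _ _ g f => act_comp f g x).

Lemma hom_cut_Jmap p (p0 : (0 <= p)%E) X Y (g : smap X Y) k (c : ncochain R Y k) s (x : J X s) :
  hom_cut p0 c s (Jmap g s x) = hom_cut p0 (nmap g c) s x.
Proof.
apply: val_inj; apply/funext => -[i j u v] /=; rewrite /ftrunc /flast /= /dq -!smap_act.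
by [].
Qed.

Lemma hom_cut_yoneda X k (c : ncochain R X k) s (x : J X s) (h : (0 < nv1 s)%N) :
  hom_cut zero_perversity_ge0 c s x = scut (nmap (yoneda (x h)) c).
Proof.
rewrite /scut -hom_cut_Jmap; congr (hom_cut _ _ _ _); apply/funext => h'.
by rewrite /= act_id; congr x; apply: bool_irrelevance.
Qed.

Lemma hom_cutD p (p0 : (0 <= p)%E) X k (c d : ncochain R X k) s (x : J X s) :
  hom_cut p0 (c + d) s x =
  (hom_cut p0 c s x : blowup R p s k) + (hom_cut p0 d s x : blowup R p s k).
Proof.
apply: val_inj; apply/funext => -[i j u v].
rewrite -[RHS]/(foldc _ _ _ _ + foldc _ _ _ _) /= /ftrunc /flast.
case: ifP => _; first by rewrite addr0.
case: ifP => _; first by case: ifP => _; rewrite ?scaler0 ?addr0 // -!scalerDr.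
case: ifP => _; first by rewrite addr0.
by case: ifP => _; rewrite ?addr0.
Qed.

Lemma hom_cut0 p (p0 : (0 <= p)%E) X k : hom_cut p0 (0 : ncochain R X k) = 0.
Proof.
apply: smap1_ext => s x; have := hom_cutD p0 (0 : ncochain R X k) 0 x; rewrite addr0 => e.
by apply: (@addrI _ (hom_cut p0 0 s x : blowup R p s k)); rewrite -e; exact: esym (addr0 _).
Qed.

Lemma scut0 s k : scut (0 : ncochain R (standard (jdim s).+1) k) = 0.
Proof. by rewrite /scut hom_cut0. Qed.

Lemma scutD s k (c d : ncochain R (standard (jdim s).+1) k) : scut (c + d) = scut c + scut d.
Proof. exact: hom_cutD. Qed.

Lemma scut_diff s k (c : ncochain R (standard (jdim s).+1) k) :
  scut (ncob c) = blowup_diff (scut c).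
Proof.
by rewrite /scut -hom_diff_cut.
Qed.

Section Tautological.
Variable k : nat.

Fact cochain_act_id m (c : ncochain R (standard m.+1) k) :
  nmap (standard_map (mono_id m.+1)) c = c.
Proof. by apply: val_inj; apply/funext => x; rewrite /= mono_idcomp. Qed.

Fact cochain_act_comp m l q (g : mono l.+1 q.+1) (f : mono m.+1 l.+1)
    (c : ncochain R (standard q.+1) k) :
  nmap (standard_map (mono_comp g f)) c = nmap (standard_map f) (nmap (standard_map g) c).
Proof. by apply: val_inj; apply/funext => x; rewrite /= mono_compA. Qed.

Definition cochain_sset : sset :=
  @SSet (fun m => ncochain R (standard m.+1) k)
    (fun m l f c => nmap (standard_map f) c) cochain_act_id cochain_act_comp.

Fact tautological_subproof :
  (fun c : cochain_sset k => val c (mono_id k.+1)) \in @is_normalized R cochain_sset k.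
Proof.
rewrite unfold_in; apply/asboolP => _ [m [f [c [mk ->]]]] /=.
have /asboolP nc := valP c; apply: nc.
by exists m, f, (mono_id _); split=> //=; rewrite mono_compid mono_idcomp.
Qed.

Definition tautological : ncochain R cochain_sset k :=
  Sub (fun c : cochain_sset k => val c (mono_id k.+1)) tautological_subproof.

Lemma nmap_tautological m (c : cochain_sset m) : nmap (yoneda c) tautological = c.
Proof. by apply: val_inj; apply/funext => f /=; rewrite mono_compid. Qed.

End Tautological.
End Representing.

(** * Classifying maps *)

Lemma smap1_inverse (K L : sset1) (u : smap1 K L) : (forall s, bijective (u s)) ->
  exists v : smap1 L K, (forall s x, u s (v s x) = x) /\ (forall s x, v s (u s x) = x).
Proof.
move=> ub; have [v vK] : exists v : forall s, L s -> K s,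
    forall s, cancel (u s) (v s) /\ cancel (v s) (u s).
  have h s : {v : L s -> K s | cancel (u s) v /\ cancel v (u s)}.
    by apply: cid; case: (ub s) => v vu uv; exists v.
  by exists (fun s => sval (h s)) => s; exact: svalP (h s).
have va s t (f : jmap s t) x : v s (act1 f x) = act1 f (v t x).
  by rewrite -[RHS](vK s).1 smap1_act (vK t).2.
by exists (SMap1 va); split=> s x; [exact: (vK s).2|exact: (vK s).1].
Qed.

Section CohomologyMapComp.
Variables (R : pzRingType) (p : perversity) (k : nat).

Lemma blowup_cohomology_map_comp K L M (v : smap1 L M) (u : smap1 K L)
    (x : blowup_cohomology R p k M) :
  blowup_cohomology_map p k (smap1_comp v u) x =
  blowup_cohomology_map p k u (blowup_cohomology_map p k v x).
Proof.
have [z ->] := coclassP x; rewrite /= !cohomology_mapE; congr coclass.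
by apply: val_inj; apply: smap1_ext.
Qed.

Lemma blowup_cohomology_map_id K (u : smap1 K K) (x : blowup_cohomology R p k K) :
  (forall s y, u s y = y) -> blowup_cohomology_map p k u x = x.
Proof.
move=> uE; have [z ->] := coclassP x; rewrite /= !cohomology_mapE; congr coclass.
by apply: val_inj; apply: smap1_ext => s y /=; rewrite uE.
Qed.

Lemma blowup_cohomology_map_bijective K L (u : smap1 K L) :
  (forall s, bijective (u s)) -> bijective (blowup_cohomology_map (R := R) p k u).
Proof.
move=> /smap1_inverse[v [uv vu]]; exists (blowup_cohomology_map p k v) => x;
  by rewrite -blowup_cohomology_map_comp blowup_cohomology_map_id.
Qed.

End CohomologyMapComp.

Section Classify.
Variables (R : pzRingType) (q : perversity) (n : nat) (K : sset1).

Fact classify_subproof (z : cocycle (blowup_cochains R q K) n) s (x : K s) :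
  val z s x \in @is_cocycle R (blowup_complex R q s) n.
Proof.
rewrite unfold_in; apply/eqP; have := valP z; rewrite unfold_in => /eqP dz.
exact: (congr1 (fun w : Defs.hom (blowup_presheaf R q) K n.+1 => w s x) dz).
Qed.

Definition classify (z : cocycle (blowup_cochains R q K) n) :
  smap1 K (cocycle_sset1 (blowup_presheaf R q) n).
Proof.
refine (@SMap1 K (cocycle_sset1 (blowup_presheaf R q) n)
  (fun s x => Sub (val z s x) (classify_subproof z x)) _).
by move=> s t f x; apply: val_inj; exact: (smap1_act (val z) f x).
Defined.

End Classify.

Lemma blowup_nonregular R p s k (w w' : blowup R p s k) : ~~ (0 < nv1 s)%N -> w = w'.
Proof.
move=> h; apply: val_inj; apply/funext => -[i j u v].
by move: h; rewrite (mono_gt0 v).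
Qed.

Section JoinBijections.
Variable R : pzRingType.

(** On a simplex [c] over a regular [s] the map is [scut c], so this is injectivity and surjectivity
    of [scut]. *)
Lemma tautological_bijective k s :
  bijective (hom_cut zero_perversity_ge0 (tautological R k) s : J (cochain_sset R k) s -> _).
Proof.
apply: injective_surjective_bijective => [x y|w].
  move=> e; apply/funext => h; apply: (scut_inj h).
  by move: e; rewrite !(hom_cut_yoneda _ _ h) !nmap_tautological.
(* Over a non-regular simplex the target is zero and the source consists of the empty function. *)
have [h|h] := boolP (0 < nv1 s)%N; last first.
  exists (fun h' => match (elimN idP h) h' with end); exact: blowup_nonregular.
have [c cw] := scut_surj w h; exists (fun=> c).
by rewrite (hom_cut_yoneda _ _ h) nmap_tautological.
Qed.

Variable n : nat.

Definition EM_cochain : smap (EM_sset R n) (cochain_sset R n) :=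
  @SMap (EM_sset R n) (cochain_sset R n) (fun m z => val z) (fun _ _ _ _ => erefl).

Definition EM_class : ncochain R (EM_sset R n) n := nmap EM_cochain (tautological R n).

Lemma nmap_EM_class m (z : EM_sset R n m) : nmap (yoneda z) EM_class = val z.
Proof. by apply: val_inj; apply/funext => f /=; rewrite mono_compid. Qed.

Lemma ncob_EM_class : ncob EM_class = 0.
Proof.
apply: val_inj; apply/funext => z.
have -> : val (ncob EM_class) z = val (nmap (yoneda z) (ncob EM_class)) (mono_id _).
  exact: congr1 _ (esym (act_id z)).
rewrite nmap_cob nmap_EM_class; have := valP z; rewrite unfold_in => /eqP dz.
have -> : ncob (val z) = 0 by exact: dz.
by [].
Qed.

Fact hom_cut_EM_class_cocycle :
  hom_cut zero_perversity_ge0 EM_class \in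
    @is_cocycle R (blowup_cochains R zero_perversity (J (EM_sset R n))) n.
Proof.
rewrite unfold_in; apply/eqP; rewrite -[LHS]/(hom_diff _) hom_diff_cut ncob_EM_class.
exact: hom_cut0.
Qed.

(** On simplices this is [scut] restricted to cocycles; as a classifying map it is natural by
    construction. *)
Definition EM_join : smap1 (J (EM_sset R n)) (EM_sset1 R n) :=
  classify (Sub (hom_cut zero_perversity_ge0 EM_class) hom_cut_EM_class_cocycle).

Lemma val_EM_join s (x : J (EM_sset R n) s) (h : (0 < nv1 s)%N) :
  val (EM_join s x) = scut (val (x h)).
Proof. by rewrite -nmap_EM_class -hom_cut_yoneda. Qed.

Lemma EM_join_bijective s : bijective (EM_join s).
Proof.
apply: injective_surjective_bijective => [x y /(congr1 val) e|w].
  apply/funext => h; apply: val_inj; apply: (scut_inj h).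
  by move: e; rewrite !(val_EM_join _ h).
have [h|h] := boolP (0 < nv1 s)%N; last first.
  exists (fun h' => match (elimN idP h) h' with end); apply: val_inj.
  exact: blowup_nonregular.
have [c cw] := scut_surj (val w) h.
have dc : c \in @is_cocycle R (ncomplex R (standard (jdim s).+1)) n.
  rewrite unfold_in; apply/eqP; have := valP w; rewrite unfold_in => /eqP dw.
  apply: (scut_inj h); rewrite scut_diff cw.
  by apply: etrans dw _; rewrite scut0.
exists (fun=> Sub c dc); apply: val_inj; rewrite (val_EM_join _ h).
exact: cw.
Qed.

End JoinBijections.

(** * Classifying maps of cohomologous cocycles *)

Section ShiftHomotopy.
Variables (R : pzRingType) (m : nat).

Definition prod_sset (X Y : sset) : sset.
Proof.
refine (@SSet (fun k => (X k * Y k)%type) (fun _ _ f x => (act f x.1, act f x.2)) _ _).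
  by move=> k [x y] /=; rewrite !act_id.
by move=> k l q g f [x y] /=; rewrite !act_comp.
Defined.

Let E := prod_sset (EM_sset R m.+1) (cochain_sset R m).

Fact dcocycle_subproof N (y : ncochain R (standard N) m) :
  ncob y \in @is_cocycle R (ncomplex R (standard N)) m.+1.
Proof. by rewrite unfold_in; apply/eqP; apply: ncobK. Qed.

Definition dcocycle N (y : ncochain R (standard N) m) : cocycle (ncomplex R (standard N)) m.+1 :=
  Sub (ncob y) (dcocycle_subproof y).

Lemma EM_act_shift k l (f : mono k.+1 l.+1) (z : EM_sset R m.+1 l) y :
  act f (z + dcocycle y : EM_sset R m.+1 l) =
  (act f z : cocycle _ _) + dcocycle (nmap (standard_map f) y) :> EM_simplex R m.+1 k.
Proof.
apply: val_inj.
rewrite -[LHS]/(nmap (standard_map f) (val z + ncob y)).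
rewrite -[RHS]/(nmap (standard_map f) (val z) + ncob (nmap (standard_map f) y)).
by rewrite raddfD /= nmap_cob.
Qed.

Definition shift : smap E (EM_sset R m.+1) :=
  @SMap E (EM_sset R m.+1) (fun k x => (x.1 : cocycle _ _) + dcocycle x.2)
    (fun k l f x => esym (EM_act_shift f x.1 x.2)).

Definition unshift : smap E (EM_sset R m.+1) :=
  @SMap E (EM_sset R m.+1) (fun k x => x.1) (fun _ _ _ _ => erefl).

Fact chi_subproof N a (y : ncochain R (standard N) m) :
  (fun s : mono m.+1 N => if (a <= ev s 0)%N then val y s else 0)
    \in @is_normalized R (standard N) m.
Proof.
rewrite unfold_in; apply/asboolP => s ds; case: ifP => // _.
by have /asboolP ny := valP y; apply: ny.
Qed.

(** The cup product of the 0-cochain that is 1 on the vertices from [a] on with [y]. As [a] runs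
    from 0 past the last vertex it deforms [y] to 0, and it depends on the cut alone, hence commutes
    with faces and degeneracies. *)
Definition chi N a (y : ncochain R (standard N) m) : ncochain R (standard N) m :=
  Sub (fun s : mono m.+1 N => if (a <= ev s 0)%N then val y s else 0) (chi_subproof a y).

Lemma nmap_chi N M (f : mono M N) a b (y : ncochain R (standard N) m) :
  (forall t, (t < M)%N -> (a <= ev f t)%N = (b <= t)%N) ->
  nmap (standard_map f) (chi a y) = chi b (nmap (standard_map f) y).
Proof.
move=> ab; apply: val_inj; apply/funext => s /=.
by rewrite ev_comp // ab // ev_lt.
Qed.

Definition shift_cut a k (x : E k) : EM_sset R m.+1 k :=
  (x.1 : cocycle _ _) + dcocycle (chi a x.2).

Lemma act_shift_cut k l (f : mono k.+1 l.+1) a b (x : E l) :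
  (forall t, (t < k.+1)%N -> (a <= ev f t)%N = (b <= t)%N) ->
  act f (shift_cut a x) = shift_cut b (act f x).
Proof. by move=> ab; rewrite [LHS]EM_act_shift (nmap_chi _ ab). Qed.

Lemma shift_homotopy k (c : ncochain R (EM_sset R m.+1) k) :
  ncob c = 0 -> coboundary (C := ncomplex R E) (nmap shift c - nmap unshift c).
Proof.
apply: (cut_homotopy (F := shift_cut)) => [a l q x ql|a l i x il ia|l x|l x].
- apply: act_shift_cut => t tl; rewrite ev_mk //; last exact: ok_bump.
  by rewrite /bump; lia.
- apply/esym/act_shift_cut => t tl; rewrite ev_mk //; last exact: ok_unbump.
  by rewrite /unbump; lia.
- rewrite /shift_cut (_ : chi 0 x.2 = x.2) //.
  by apply: val_inj; apply/funext => s.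
rewrite /shift_cut (_ : dcocycle _ = 0) ?addr0 //.
rewrite (_ : chi _ _ = 0); first by apply: val_inj; exact: linear0.
apply: val_inj; apply/funext => s /=; case: ifP => // ls.
by have := ev_lt s (ltn0Sn m); lia.
Qed.

End ShiftHomotopy.

Section Cohomologous.
Variables (R : pzRingType) (p : perversity) (k : nat).
Hypothesis p0 : (0 <= p)%E.

(** Restriction to the cut 0 is natural and injective in cohomology, so a statement about ordinary
    cochains suffices. *)
Lemma cohomology_Jmap_eq X Y (g0 g1 : smap X Y) :
  (forall c : ncochain R Y k, ncob c = 0 ->
    coboundary (C := ncomplex R X) (nmap g0 c - nmap g1 c)) ->
  forall x : blowup_cohomology R p k (J Y),
    blowup_cohomology_map p k (Jmap g0) x = blowup_cohomology_map p k (Jmap g1) x.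
Proof.
move=> h x; have [z ->] := coclassP x.
apply: (bij_inj (cohomology_ncut_bijective R X p0 k)).
rewrite /= !cohomology_mapE; apply/coclass_eq.
have dz : hom_diff (val z) = 0 by have := valP z; rewrite unfold_in => /eqP.
rewrite -[X in coboundary X]/(ncut R p X k (hom_pull (Jmap g0) (val z))
  - ncut R p X k (hom_pull (Jmap g1) (val z))).
rewrite !ncut_Jmap; apply: h.
have := cappd (ncut R p Y) (val z).
by rewrite -[diff _ _ (val z)]/(hom_diff (val z)) dz linear0 => /esym.
Qed.

Lemma classify_cohomologous n L (z0 z1 : cocycle (blowup_cochains R zero_perversity L) n) :
  coboundary (val z0 - val z1) ->
  forall x : blowup_cohomology R p k (EM_sset1 R n),
    blowup_cohomology_map p k (classify z0) x = blowup_cohomology_map p k (classify z1) x.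
Proof.
case: n z0 z1 => [|m] z0 z1 /=.
  by move=> /eqP; rewrite subr_eq0 => /eqP e x; have -> : z0 = z1 by apply: val_inj.
move=> [y zy] x.
have [phi [phiK _]] := smap1_inverse (EM_join_bijective R m.+1).
pose T : smap1 (J (cochain_sset R m)) (degree_sset1 (blowup_presheaf R zero_perversity) m) :=
  hom_cut zero_perversity_ge0 (tautological R m).
have [psi [psiK _]] : exists v : smap1 (degree_sset1 (blowup_presheaf R zero_perversity) m)
    (J (cochain_sset R m)), (forall s x, T s (v s x) = x) /\ (forall s x, v s (T s x) = x).
  by apply: smap1_inverse => s; exact: tautological_bijective.
have pairing_act s t (f : jmap s t) (l : L t) :
    (fun h => (phi s (classify z1 s (act1 f l)) h, psi s (y s (act1 f l)) h)) =
    @act1 (J (prod_sset (EM_sset R m.+1) (cochain_sset R m))) s t f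
      (fun h => (phi t (classify z1 t l) h, psi t (y t l) h)).
  by apply/funext => h; rewrite !smap1_act.
(* As z0 = z1 + delta y, both classifying maps factor through the pair (z1, y), read in J through
   the inverses [phi] and [psi]. *)
pose pairing : smap1 L (J (prod_sset (EM_sset R m.+1) (cochain_sset R m))) :=
  @SMap1 L (J (prod_sset (EM_sset R m.+1) (cochain_sset R m)))
    (fun s l h => (phi s (classify z1 s l) h, psi s (y s l) h)) pairing_act.
have -> : classify z1 = smap1_comp (EM_join R m.+1) (smap1_comp (Jmap (unshift R m)) pairing).
  by apply: smap1_ext => s l; rewrite /= -[LHS]phiK.
have -> : classify z0 = smap1_comp (EM_join R m.+1) (smap1_comp (Jmap (shift R m)) pairing).
  apply: smap1_ext => s l; apply: val_inj.
  have [h|h] := boolP (0 < nv1 s)%N; last exact: blowup_nonregular.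
  rewrite (val_EM_join _ h) -[val _ in RHS]/(val (phi s (classify z1 s l) h) + ncob (psi s (y s l) h)).
  rewrite scutD scut_diff -val_EM_join phiK.
  have -> : scut (psi s (y s l) h) = y s l.
    by rewrite -[RHS]psiK /T (hom_cut_yoneda _ _ h) nmap_tautological.
  have zys := congr1 (fun w : Defs.hom _ _ _ => w s l) zy.
  by rewrite -[blowup_diff _]/((hom_diff y) s l) -zys /= addrC subrK.
rewrite !blowup_cohomology_map_comp; congr (blowup_cohomology_map _ _ _ _).
by apply: cohomology_Jmap_eq => c; exact: shift_homotopy.
Qed.

End Cohomologous.

(** * The universal class and the Yoneda lemma *)

Section Universal.
Variables (R : pzRingType) (q : perversity) (n : nat).

Definition universal_cochain :
    Defs.hom (blowup_presheaf R q) (cocycle_sset1 (blowup_presheaf R q) n) n :=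
  @SMap1 (cocycle_sset1 (blowup_presheaf R q) n) (degree_sset1 (blowup_presheaf R q) n)
    (fun s z => val z) (fun _ _ _ _ => erefl).

Fact universal_subproof : universal_cochain \in
  @is_cocycle R (blowup_cochains R q (cocycle_sset1 (blowup_presheaf R q) n)) n.
Proof.
rewrite unfold_in; apply/eqP; apply: smap1_ext => s z.
by have := valP z; rewrite unfold_in => /eqP.
Qed.

Definition universal : cocycle (blowup_cochains R q (cocycle_sset1 (blowup_presheaf R q) n)) n :=
  Sub universal_cochain universal_subproof.

Lemma classify_universal s z : classify universal s z = z.
Proof. exact: val_inj. Qed.

Lemma classify_pull K (z : cocycle (blowup_cochains R q K) n) :
  blowup_cohomology_map q n (classify z) (coclass universal) = coclass z.
Proof.
rewrite /= cohomology_mapE; congr coclass; apply: val_inj; exact: smap1_ext.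
Qed.

End Universal.

Lemma coboundary_repr R (C : complex R) n (z : cocycle C n) :
  coboundary (val (repr (coclass z)) - val z).
Proof. by apply/coclass_eq; rewrite /coclass reprK. Qed.

Section Main.
Variables (R : comPzRingType) (p : perversity) (n k : nat).
Hypothesis p0 : (0 <= p)%E.

Let H := blowup_cohomology R p k (EM_sset1 R n).
Let N := nat_trans R zero_perversity n p k.

(** The chosen representative of the pulled-back class is only cohomologous to the pullback of the
    chosen representative of [y]. *)
Fact pull_natural (x : H) K L (u : smap1 K L) (y : blowup_cohomology R zero_perversity n L) :
  blowup_cohomology_map p k (classify (repr (blowup_cohomology_map zero_perversity n u y))) x =
  blowup_cohomology_map p k u (blowup_cohomology_map p k (classify (repr y)) x).
Proof.
rewrite -blowup_cohomology_map_comp.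
pose z := cocycle_map (hom_complex_map (blowup_presheaf R zero_perversity) u) (repr y).
have -> : smap1_comp (classify (repr y)) u = classify z.
  by apply: smap1_ext => s a; apply: val_inj.
apply: classify_cohomologous => //; exact: coboundary_repr.
Qed.

Definition pull (x : H) : N := NatTrans (pull_natural x).

Definition at_universal (T : N) : H := T _ (coclass (universal R zero_perversity n)).

Lemma pullK : cancel pull at_universal.
Proof.
move=> x; rewrite /at_universal /=.
(* The chosen representative of the universal class need not be [universal], whose classifying map
   is the identity. *)
rewrite (classify_cohomologous p0 (coboundary_repr _)).
by apply: blowup_cohomology_map_id => s z; apply: classify_universal.
Qed.

(** Naturality of [T] along the classifying map of [y], which pulls the universal class back to
    [y]. *)
Lemma at_universalK : cancel at_universal pull.
Proof.
move=> T; apply: nat_trans_ext => K y /=.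
rewrite /at_universal -nat_natural classify_pull; congr (T K _).
by rewrite /coclass reprK.
Qed.

Lemma pull_linear (a : R) x y : pull (a *: x + y) = nat_add (nat_scale a (pull x)) (pull y).
Proof. by apply: nat_trans_ext => K z; rewrite /= linearP. Qed.

Definition restrict_universal (T : N) : cohomology (ncomplex R (EM_sset R n)) k :=
  cohomology_map (ncut R p (EM_sset R n)) (blowup_cohomology_map p k (EM_join R n) (at_universal T)).

Lemma restrict_universal_bijective : bijective restrict_universal.
Proof.
apply: bij_comp; first exact: cohomology_ncut_bijective.
apply: bij_comp.
  by apply: blowup_cohomology_map_bijective => s; exact: EM_join_bijective.
by exists pull; [exact: at_universalK|exact: pullK].
Qed.

Lemma restrict_universal_linear (a : R) S T :
  restrict_universal (nat_add (nat_scale a S) T) =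
  a *: restrict_universal S + restrict_universal T.
Proof. by rewrite /restrict_universal -linearP -linearP. Qed.

End Main.

Theorem theorem6p10 (R : idomainType) (p : perversity) (n k : nat) :
  dedekind R -> (0 <= p)%E ->
  (exists F : blowup_cohomology R p k (EM_sset1 R n) ->
              nat_trans R zero_perversity n p k,
     bijective F /\
     forall (a : R) x y, F (a *: x + y) = nat_add (nat_scale a (F x)) (F y)) /\
  (exists G : nat_trans R zero_perversity n p k ->
              cohomology (ncomplex R (EM_sset R n)) k,
     bijective G /\
     forall (a : R) S T, G (nat_add (nat_scale a S) T) = a *: G S + G T).
Proof.
move=> _ p0; split.
  exists (pull (R := R) p0); split=> [|a x y]; last exact: pull_linear.
  exists (@at_universal R p n k); [exact: pullK|exact: at_universalK].
exists (@restrict_universal R p n k); split=> [|a S T].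
  exact: restrict_universal_bijective.
exact: restrict_universal_linear.
Qed.
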